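(* Assume hypothesis (H): there exists a constant $d \ge 1$ such that every language in $\mathrm{P}$ can be decided by Boolean circuits of size $O(n^d)$, i.e. $\mathrm{P} \subseteq \mathrm{Size}(n^d)$. Then for every $0<\epsilon<1$ and $s = s(k) := 2^{\epsilon k}$, the theory $T_{\mathrm{PV}}$ does not prove the sentence $$\forall 1^m\,(m=2^k>1)\ \exists y\in\{0,1\}^m\ \forall x\in\{0,1\}^n,\quad \mathbf{tt}_{s,k}(x)\neq y$$ expressing the dual weak pigeonhole principle for the truth-table function $\mathbf{tt}_{s,k}$, where $n := 10\, s \log s$.
   Context: **Language and theory.** $L_{\mathrm{PV}}$ is the first-order language having a function symbol for every deterministic polynomial-time clocked Turing machine (of any number of inputs). The symbol is interpreted over the standard model $\mathbf{N}$ by the function the machine computes, where natural numbers are identified with finite binary strings in a standard p-time way. Relations computable by p-time machines are represented by their characteristic functions. $T_{\mathrm{PV}}$ is the first-order theory whose axioms are all universal $L_{\mathrm{PV}}$-sentences (universal quantifiers in front of a quantifier-free formula) that are true in $\mathbf{N}$. ''Does not prove'' means not derivable in first-order logic with equality from these axioms. **Circuits and hypothesis (H).** $\mathrm{Size}(n^d)$ is, as used in (H), the class of languages $L\subseteq\{0,1\}^*$ for which there is a constant $c$ such that for every $n\ge 1$ the characteristic function of $L\cap\{0,1\}^n$ is computed by a general Boolean circuit (over a fixed finite complete basis) with $n$ inputs and of size at most $c\,n^d$. There is no uniformity requirement. In (H) the constant $d$ is the same for all languages in $\mathrm{P}$, while the constant $c$ may depend on the language. **Truth-table function.** $\mathbf{tt}_{s,k}$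 takes as input (a code of) a Boolean circuit with $k$ inputs and of size $\le s$, and outputs its truth table, i.e. the string of $2^k$ bits listing the values of the circuit on all inputs from $\{0,1\}^k$ in lexicographic order. A fixed standard p-time encoding is used in which circuits of size $\le s$ are encoded by strings of exactly $n = 10\,s\log s$ bits ($\log$ is base 2). The quantities $s=2^{\epsilon k}$ and $n$ are read as integers ($s$ rounded down, $n$ rounded up); the encoding covers all circuits with $k$ inputs and size $\le s$ for all sufficiently large $k$, and strings not coding such a circuit are mapped to the all-zero string $0^{2^k}$. Thus $\mathbf{tt}_{s,k}:\{0,1\}^n\to\{0,1\}^m$ with $m=2^k$, and it maps a smaller set into a bigger one whenever $10\,s\log s<2^k$. For any fixed $0<\epsilon<1$ the function $\mathbf{tt}_{s,k}$ is taken to be a p-time function (time polynomial in $m=2^k$), and so is available in $L_{\mathrm{PV}}$. **Formal sentence.** The displayed sentence is the $L_{\mathrm{PV}}$-sentence $\forall z\,\exists y\,\forall x\, R(z,y,x)$, where $R$ is the p-time relation (a quantifier-free $L_{\mathrm{PV}}$-formula) stating: if $z=1^m$ (the string of $m$ ones) with $m=2^k>1$ for some integer $k$, then $y$ has length exactly $m$, and if $x$ has length exactly $n=n(k)$ then $\mathbf{tt}_{s,k}(x)\ne y$. *)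

(* Defs.v *)
From mathcomp Require Import all_boot all_order all_algebra.
From mathcomp Require Import reals exp.

Set Implicit Arguments.
Unset Strict Implicit.
Unset Printing Implicit Defensive.

(* Natural numbers are identified with binary strings by bijective base-2
   numeration, least significant digit first: the bits [false] and [true]
   stand for the digits 1 and 2, and [::] for 0. *)
Fixpoint nat_of_str (s : seq bool) : nat :=
  if s is b :: s' then (nat_of_str s').*2 + b.+1 else 0.

Fixpoint str_succ (s : seq bool) : seq bool :=
  match s with
  | [::] => [:: false]
  | false :: s' => true :: s'
  | true :: s' => false :: str_succ s'
  end.

Definition str_of_nat (n : nat) : seq bool := iter n str_succ [::].

Lemma nat_of_str_succ (s : seq bool) : nat_of_str (str_succ s) = (nat_of_str s).+1.
Proof.
elim: s => [|[] s IHs] //=; last by rewrite addn2 addn1.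
by rewrite IHs doubleS addn1 addn2.
Qed.

Lemma str_of_natK : cancel str_of_nat nat_of_str.
Proof. by elim=> [|n IHn] //; rewrite /str_of_nat iterS nat_of_str_succ -/(str_of_nat n) IHn. Qed.

Lemma nat_of_strK : cancel nat_of_str str_of_nat.
Proof.
have dbl n : str_of_nat (n.*2).+1 = false :: str_of_nat n.
  elim: n => // n IHn; rewrite doubleS /str_of_nat iterS iterS.
  by rewrite -/(str_of_nat _) IHn.
elim=> [|[] s IHs] //=; last by rewrite addn1 dbl IHs.
by rewrite addn2 [LHS]/str_of_nat iterS -/(str_of_nat _) dbl IHs.
Qed.

(* The blank symbol is [None]. *)
Definition symbol := option bool.

(* A two-way infinite tape.  The head scans the first symbol of [tright];
   [tleft] lists the cells to its left, nearest first.  All the cells that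
   are not listed are blank. *)
Record tape := Tape { tleft : seq symbol; tright : seq symbol }.

Inductive move := MLeft | MStay | MRight.

Definition tread (t : tape) : symbol := head None (tright t).

Definition twrite (a : symbol) (t : tape) : tape :=
  Tape (tleft t) (a :: behead (tright t)).

Definition tmove (d : move) (t : tape) : tape :=
  match d with
  | MLeft => Tape (behead (tleft t)) (head None (tleft t) :: tright t)
  | MStay => t
  | MRight => Tape (tread t :: tleft t) (behead (tright t))
  end.

Definition tape_of_str (s : seq bool) : tape := Tape [::] (map Some s).

(* The string from the scanned cell rightwards up to the first blank. *)
Definition str_of_tape (t : tape) : seq bool :=
  pmap id (take (index None (tright t)) (tright t)).

(* The states are [0, ..., mstates - 1].  Tapes of a machine with [a] inputs and
   [mwork] work tapes: [inl i] is the [i]-th input tape, [inr None] the output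
   tape, [inr (Some w)] the work tapes. *)
Definition tape_index (a w : nat) : finType := ('I_a + option 'I_w)%type.

Record machine (a : nat) := Machine {
  mstates : nat;
  mwork : nat;
  mstart : 'I_mstates;
  mhalt : pred 'I_mstates;
  mtrans : 'I_mstates -> {ffun tape_index a mwork -> symbol} ->
           'I_mstates * {ffun tape_index a mwork -> symbol * move}
}.

Definition config (a : nat) (M : machine a) : Type :=
  'I_(mstates M) * {ffun tape_index a (mwork M) -> tape}.

Definition mstep (a : nat) (M : machine a) (c : config M) : config M :=
  if mhalt c.1 then c else
  let r := mtrans c.1 [ffun i => tread (c.2 i)] in
  (r.1, [ffun i => tmove (r.2 i).2 (twrite (r.2 i).1 (c.2 i))]).

Definition minit (a : nat) (M : machine a) (x : 'I_a -> seq bool) : config M :=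
  (mstart M, [ffun i => if i is inl j then tape_of_str (x j) else tape_of_str [::]]).

(* A machine together with the exponent of its polynomial clock: on inputs of
   total length [n] it is stopped after [n ^ cexp + cexp] steps, if it has not
   halted before. *)
Record clocked (a : nat) := Clocked { cmachine : machine a; cexp : nat }.

Definition clocked_run (a : nat) (f : clocked a) (x : 'I_a -> seq bool) : seq bool :=
  let n := \sum_(i < a) size (x i) in
  let c := iter (n ^ cexp f + cexp f) (@mstep a (cmachine f)) (minit (cmachine f) x) in
  str_of_tape (c.2 (inr None)).

(* Terms and formulas over a signature [S] of function symbols by arity, with
   de Bruijn variables. *)
Unset Elimination Schemes.
Inductive term (S : nat -> Type) : Type :=
| Var of nat
| App (a : nat) of S a & {ffun 'I_a -> term S}.
Set Elimination Schemes.
Arguments Var {S}.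

Lemma term_ind (S : nat -> Type) (P : term S -> Prop) :
  (forall i, P (Var i)) ->
  (forall (a : nat) (f : S a) (ts : {ffun 'I_a -> term S}),
     (forall i, P (ts i)) -> P (App f ts)) ->
  forall t, P t.
Proof. by move=> PV PA; fix IHt 1 => -[i|a f ts]; [apply: PV | apply: PA => i; apply: IHt]. Qed.

Inductive formula (S : nat -> Type) : Type :=
| Bot
| Eq of term S & term S
| Imp of formula S & formula S
| All of formula S.
Arguments Bot {S}.

Definition Neg (S : nat -> Type) (A : formula S) : formula S := Imp A Bot.
Definition Ex (S : nat -> Type) (A : formula S) : formula S := Neg (All (Neg A)).

Fixpoint tsubst (S : nat -> Type) (r : nat -> term S) (t : term S) : term S :=
  match t with
  | Var i => r i
  | App a f ts => App f [ffun i => tsubst r (ts i)]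
  end.

Definition scons (T : Type) (x : T) (e : nat -> T) (i : nat) : T :=
  if i is j.+1 then e j else x.

Definition tshift (S : nat -> Type) : term S -> term S := tsubst (fun i => Var i.+1).

Fixpoint fsubst (S : nat -> Type) (r : nat -> term S) (A : formula S) : formula S :=
  match A with
  | Bot => Bot
  | Eq t u => Eq (tsubst r t) (tsubst r u)
  | Imp B C => Imp (fsubst r B) (fsubst r C)
  | All B => All (fsubst (scons (Var 0) (fun i => tshift (r i))) B)
  end.

Definition fshift (S : nat -> Type) : formula S -> formula S := fsubst (fun i => Var i.+1).

Definition finst (S : nat -> Type) (A : formula S) (t : term S) : formula S :=
  fsubst (scons t Var) A.

Fixpoint tbounded (S : nat -> Type) (n : nat) (t : term S) : bool :=
  match t with
  | Var i => i < n
  | App a f ts => [forall i, tbounded n (ts i)]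
  end.

Fixpoint fbounded (S : nat -> Type) (n : nat) (A : formula S) : bool :=
  match A with
  | Bot => true
  | Eq t u => tbounded n t && tbounded n u
  | Imp B C => fbounded n B && fbounded n C
  | All B => fbounded n.+1 B
  end.

Definition sentence (S : nat -> Type) (A : formula S) : bool := fbounded 0 A.

Fixpoint quantifier_free (S : nat -> Type) (A : formula S) : bool :=
  match A with
  | Bot | Eq _ _ => true
  | Imp B C => quantifier_free B && quantifier_free C
  | All _ => false
  end.

Definition universal_sentence (S : nat -> Type) (A : formula S) : Prop :=
  sentence A /\ exists n B, A = iter n (@All S) B /\ quantifier_free B.

(* Natural deduction from a possibly infinite set of premises. *)
Inductive proves (S : nat -> Type) : (formula S -> Prop) -> formula S -> Prop :=
| PrAx (G : formula S -> Prop) A : G A -> proves G A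
| PrImpI (G : formula S -> Prop) A B :
    proves (fun C => C = A \/ G C) B -> proves G (Imp A B)
| PrImpE (G : formula S -> Prop) A B : proves G (Imp A B) -> proves G A -> proves G B
| PrRaa (G : formula S -> Prop) A :
    proves (fun C => C = Neg A \/ G C) Bot -> proves G A
| PrAllI (G : formula S -> Prop) A :
    proves (fun C => exists2 B, G B & C = fshift B) A -> proves G (All A)
| PrAllE (G : formula S -> Prop) A t : proves G (All A) -> proves G (finst A t)
| PrRefl (G : formula S -> Prop) t : proves G (Eq t t)
| PrSubst (G : formula S -> Prop) A t u :
    proves G (Eq t u) -> proves G (finst A t) -> proves G (finst A u).

Record structure (S : nat -> Type) := Structure {
  dom : Type;
  interp : forall a, S a -> ('I_a -> dom) -> dom
}.

Fixpoint teval (S : nat -> Type) (M : structure S) (e : nat -> dom M) (t : term S) : dom M :=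
  match t with
  | Var i => e i
  | App a f ts => @interp S M a f (fun i => teval e (ts i))
  end.

Fixpoint sat (S : nat -> Type) (M : structure S) (e : nat -> dom M) (A : formula S) : Prop :=
  match A with
  | Bot => False
  | Eq t u => teval e t = teval e u
  | Imp B C => sat e B -> sat e C
  | All B => forall d, sat (scons d e) B
  end.

Definition std_model : structure clocked :=
  @Structure clocked nat
    (fun a f x => nat_of_str (clocked_run f (fun i => str_of_nat (x i)))).

Definition T_PV (A : formula clocked) : Prop :=
  universal_sentence A /\ forall e : nat -> dom std_model, sat e A.

(* Straight-line circuits over the basis {not, and, or}.  In a circuit with [n]
   inputs, wires [0, ..., n - 1] are the inputs and wire [n + i] is the output
   of gate [i]; the last wire is the output of the circuit.  The size is the
   number of gates. *)
Inductive gate := GNot of nat | GAnd of nat & nat | GOr of nat & nat.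

Definition circuit := seq gate.

Definition gate_wf (n : nat) (g : gate) : bool :=
  match g with
  | GNot i => i < n
  | GAnd i j | GOr i j => (i < n) && (j < n)
  end.

Fixpoint circuit_wf (n : nat) (C : circuit) : bool :=
  if C is g :: C' then gate_wf n g && circuit_wf n.+1 C' else true.

Definition gate_val (ws : seq bool) (g : gate) : bool :=
  match g with
  | GNot i => ~~ nth false ws i
  | GAnd i j => nth false ws i && nth false ws j
  | GOr i j => nth false ws i || nth false ws j
  end.

Fixpoint wires (ws : seq bool) (C : circuit) : seq bool :=
  if C is g :: C' then wires (rcons ws (gate_val ws g)) C' else ws.

Definition circuit_eval (C : circuit) (u : seq bool) : bool := last false (wires u C).

Definition language := seq bool -> bool.

Definition in_P (L : language) : Prop :=
  exists f : clocked 1, forall u, clocked_run f (fun=> u) = [:: L u].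

Definition in_Size (d : nat) (L : language) : Prop :=
  exists c : nat, forall n, 0 < n ->
    exists C : circuit,
      [/\ circuit_wf n C, size C <= c * n ^ d
        & forall u, size u = n -> circuit_eval C u = L u].

Definition bin_nat (s : seq bool) : nat := foldr (fun (b : bool) v => b + v.*2) 0 s.

(* A gate is coded by a block of [2 + 2 * w] bits: a two-bit opcode followed by
   two wire numbers in binary, [w] bits each, least significant bit first (the
   second one is ignored for a negation).  The opcode 00 marks padding. *)
Definition gate_of_block (w : nat) (b : seq bool) : option gate :=
  let i := bin_nat (take w (drop 2 b)) in
  let j := bin_nat (take w (drop (2 + w) b)) in
  match b with
  | false :: true :: _ => Some (GNot i)
  | true :: false :: _ => Some (GAnd i j)
  | true :: true :: _ => Some (GOr i j)
  | _ => None
  end.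

(* Circuits with [k] inputs and of size at most [s] have at most [k + s] wires,
   hence the width [up_log 2 (k + s)].  For large [s] and [k = O(log s)] the
   [s] blocks take [s * (2 + 2 * w) <= 10 * s * log s] bits; what remains of the
   string is padding. *)
Definition decode (s k : nat) (x : seq bool) : option circuit :=
  let w := up_log 2 (k + s) in
  let l := 2 + 2 * w in
  let C := pmap (gate_of_block w) [seq take l (drop (i * l) x) | i <- iota 0 (size x %/ l)] in
  if circuit_wf k C && (size C <= s) then Some C else None.

Fixpoint lex_bitstrings (k : nat) : seq (seq bool) :=
  if k is k'.+1 then
    [seq false :: u | u <- lex_bitstrings k'] ++ [seq true :: u | u <- lex_bitstrings k']
  else [:: [::]].

Definition tt (s k : nat) (x : seq bool) : seq bool :=
  if decode s k x is Some C then [seq circuit_eval C u | u <- lex_bitstrings k]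
  else nseq (2 ^ k) false.

Definition tt_size (R : realType) (eps : R) (k : nat) : nat :=
  Num.truncn (powR 2 (eps * k%:R))%R.

Definition tt_inputs (R : realType) (eps : R) (k : nat) : nat :=
  let s : R := ((tt_size eps k)%:R)%R in
  `|Num.ceil (10 * s * (ln s / ln 2))%R|%N.

Definition dwphp_rel (R : realType) (eps : R) (z y x : seq bool) : Prop :=
  forall k, 1 < 2 ^ k -> z = nseq (2 ^ k) true ->
    size y = 2 ^ k /\
    (size x = tt_inputs eps k -> tt (tt_size eps k) k x <> y).

(* [A] stands for the open formula R(z,y,x): the variables 2, 1, 0 are z, y, x,
   as bound in [dwphp_sentence].  That such an [A] exists is the assumption that
   tt is p-time for the given [eps]; any two of them are equivalent in T_PV. *)
Definition defines_dwphp_rel (R : realType) (eps : R) (A : formula clocked) : Prop :=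
  [/\ quantifier_free A, fbounded 3 A
    & forall (z y x : seq bool) (e : nat -> dom std_model),
        sat (scons (nat_of_str x : dom std_model)
              (scons (nat_of_str y : dom std_model)
                (scons (nat_of_str z : dom std_model) e))) A
        <-> dwphp_rel eps z y x].

Definition dwphp_sentence (A : formula clocked) : formula clocked := All (Ex (All A)).

(* Main.v *)
Require Import Defs.
From mathcomp Require Import all_boot all_order all_algebra.
From mathcomp Require Import reals exp.
From mathcomp Require Import boolp classical_sets filter zify.

Set Implicit Arguments.
Unset Strict Implicit.
Unset Printing Implicit Defensive.

Import Order.TTheory GRing.Theory Num.Theory.

(* The sentence is refuted in a model of T_PV.  Its elements are the sequences
   of strings [g k] computable in time 2^O(k) by a fixed program from advice of
   length 2^o(k), modulo an ultrafilter on the indices [k] that contains the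
   cofinite sets.  They are closed under the functions of L_PV, so that the true
   universal sentences hold.

   The string 1^(2^k) is an element.  Let [y] be an element with |y k| = 2^k.
   For each q, the bits of [y k] form a language in P once the input (an index
   and the advice) is padded to length about 2^(k/q); hypothesis (H), with the
   advice hardwired, gives circuits for [y k] of size 2^O(d k/q).  Hence the
   minimal circuits for [y k] have size 2^o(k), and their padded codes [x k],
   which are their own advice, form an element with tt (x k) = y k. *)

(** * Programs on infinite tapes *)

(** The argument rests on [d] being the same for all of P. For circuits of size 2^(k/q) the input
    may only have length about 2^(k/(q(d+1))). A running time 2^O(k) is a polynomial in that length,
    whose degree grows with q; the exponent of the circuit bound stays [d]. With an exponent
    depending on the language, the growth of the degree could cancel the gain from a larger q.

    Advice of length 2^o(k) fits on such inputs for every q. It is also long enough to hold the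
    circuits obtained from them, so these become elements without being computed. As 2^(eps k)
    exceeds every 2^o(k), each positive eps is covered. Loop bounds and clocks of size 2^O(k) have
    O(k) binary digits and are supplied as advice too.

    The model has too few elements for the theorem of Łoś beyond quantifier-free formulas, which is
    why universal axioms matter.

    Multi-tape machines are awkward to compose. Sequences are therefore presented by programs of a
    small language; programs simulate machines for the closure under functions, and are compiled to
    machines for (H). *)

Definition itape : Type := ((nat -> symbol) * (nat -> symbol))%type.

(** Lists of cells that differ by trailing blanks become equal, so that a program that leaves its
    string and comes back restores the tape up to equality. *)
Definition itape_of (t : tape) : itape := (nth None (tleft t), nth None (tright t)).

Definition iread (T : itape) : symbol := T.2 0.

Definition iact (p : symbol * move) (T : itape) : itape :=
  let R := scons p.1 (fun i => T.2 i.+1) in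
  match p.2 with
  | MLeft => (fun i => T.1 i.+1, scons (T.1 0) R)
  | MStay => (T.1, R)
  | MRight => (scons p.1 T.1, fun i => T.2 i.+1)
  end.

Lemma iread_of t : iread (itape_of t) = tread t.
Proof. by case: t => l [|a r]. Qed.

Lemma iact_of p t : iact p (itape_of t) = itape_of (tmove p.2 (twrite p.1 t)).
Proof.
case: p t => a [] [l r] /=; congr pair; apply: funext => i /=.
- by rewrite nth_behead.
- by case: i => [|[|i]] /=; [case: l | | rewrite nth_behead].
- by case: i => //= i; rewrite nth_behead.
- by case: i.
- by rewrite nth_behead.
Qed.

Lemma iact_id T : iact (iread T, MStay) T = T.
Proof. by case: T => L R; congr pair; apply: funext => -[]. Qed.

Lemma itape_of_blank l r m n :
  itape_of (Tape (l ++ nseq m None) (r ++ nseq n None)) = itape_of (Tape l r).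
Proof.
by congr pair; apply: funext => i; rewrite /= nth_cat nth_nseq if_same;
   case: ltnP => // ?; rewrite nth_default.
Qed.

Inductive cmd (K : Type) : Type :=
| Act of ((K -> symbol) -> K -> symbol * move)
| Seq of cmd K & cmd K
| While of ((K -> symbol) -> bool) & cmd K.

Definition heads (K : Type) (s : K -> itape) (i : K) : symbol := iread (s i).

Definition act_state (K : Type) (g : (K -> symbol) -> K -> symbol * move)
  (s : K -> itape) (i : K) : itape := iact (g (heads s) i) (s i).

(** By [ExLe] the number is only an upper bound on the time. A loop pays one step for each test and
    one for each jump back, as in the compiled code. *)
Inductive exec (K : Type) : cmd K -> (K -> itape) -> nat -> (K -> itape) -> Prop :=
| ExAct g s : exec (Act g) s 1 (act_state g s)
| ExSeq c1 c2 s s1 s2 t1 t2 :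
    exec c1 s t1 s1 -> exec c2 s1 t2 s2 -> exec (Seq c1 c2) s (t1 + t2) s2
| ExStop (b : (K -> symbol) -> bool) c s : ~~ b (heads s) -> exec (While b c) s 1 s
| ExLoop (b : (K -> symbol) -> bool) c s s1 s2 t1 t2 : b (heads s) ->
    exec c s t1 s1 -> exec (While b c) s1 t2 s2 -> exec (While b c) s (t1 + t2 + 2) s2
| ExLe c s s' t t' : exec c s t s' -> t <= t' -> exec c s t' s'.

(* [Jump b n] continues with the next instruction if [b] holds, at [n] otherwise. *)
Inductive instr (K : Type) : Type :=
| Do of ((K -> symbol) -> K -> symbol * move)
| Jump of ((K -> symbol) -> bool) & nat.

(** Jump targets are absolute, hence the address [o] at which the code is placed;
    [Jump (fun=> false) o] is the unconditional jump back. *)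
Fixpoint compile (K : Type) (o : nat) (c : cmd K) : seq (instr K) :=
  match c with
  | Act g => [:: Do g]
  | Seq c1 c2 => let p := compile o c1 in p ++ compile (o + size p) c2
  | While b c =>
      let p := compile o.+1 c in Jump b (o + size p + 2) :: p ++ [:: Jump (fun=> false) o]
  end.

Definition code_step (K : Type) (p : seq (instr K)) (x : nat * (K -> itape)) :=
  match onth p x.1 with
  | Some (Do g) => (x.1.+1, act_state g x.2)
  | Some (Jump b n) => (if b (heads x.2) then x.1.+1 else n, x.2)
  | None => x
  end.

Lemma onth_size (T : Type) (p q : seq T) x : onth (p ++ x :: q) (size p) = Some x.
Proof. by elim: p. Qed.

Lemma exec_compile (K : Type) (c : cmd K) s t s' :
  exec c s t s' -> forall p q, exists2 t', t' <= t &
    let code := p ++ compile (size p) c ++ q in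
    iter t' (code_step code) (size p, s) = (size p + size (compile (size p) c), s').
Proof.
elim=> {c s t s'} [g s|c1 c2 s s1 s2 t1 t2 _ IH1 _ IH2|b c s nb|b c s s1 s2 t1 t2 bs _ IH1 _ IH2|
  c s s' t t' _ IH le_t] p q /=.
- by exists 1 => //=; rewrite /code_step /= onth_size addn1.
- have [u1 le1] := IH1 p (compile (size p + size (compile (size p) c1)) c2 ++ q).
  have [u2 le2] := IH2 (p ++ compile (size p) c1) q.
  rewrite !size_cat -!catA => E2 E1; exists (u2 + u1); first lia.
  by rewrite iterD E1 E2 addnA.
- exists 1 => //=; rewrite /code_step /= onth_size /= (negPf nb).
  by rewrite size_cat /=; congr pair; lia.
- set P := compile _ c.
  have [u1 le1] := IH1 (rcons p (Jump b (size p + size P + 2))) (Jump (fun=> false) (size p) :: q).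
  have [u2 le2] := IH2 p q.
  rewrite size_rcons -/P !cat_rcons /= -/P -!catA /=.
  set code := p ++ _ => E2 E1.
  have Eb : code_step code (size p, s) = ((size p).+1, s).
    by rewrite /code_step /= onth_size bs.
  have Ee : code_step code ((size p).+1 + size P, s1) = (size p, s1).
    have -> : code = (rcons p (Jump b (size p + size P + 2)) ++ P) ++ Jump (fun=> false) (size p)
      :: q.
      by rewrite -catA cat_rcons.
    have -> : (size p).+1 + size P = size (rcons p (Jump b (size p + size P + 2)) ++ P).
      by rewrite size_cat size_rcons.
    by rewrite /code_step /= onth_size.
  exists (u2 + (1 + (u1 + 1))); first lia.
  by rewrite iterD iterD iterD [iter 1 _ (size p, s)]/= Eb E1 /= Ee.
- by have [u le_u E] := IH p q; exists u => //; lia.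
Qed.

Definition stay_act (K : Type) (h : K -> symbol) (i : K) : symbol * move := (h i, MStay).

Lemma act_state_id (K : Type) (s : K -> itape) : act_state (@stay_act K) s = s.
Proof. by apply: funext => i; apply: iact_id. Qed.

Lemma mstep_halt (a : nat) (M : machine a) (cf : config M) : mhalt cf.1 -> mstep cf = cf.
Proof. by rewrite /mstep => ->. Qed.

(** * Compilation of programs to clocked machines *)

Section Decider.

Variables (K : finType) (c : cmd (option K)) (out : K).

Let code := compile 0 c.
Let len := size code.

Definition instr_next (x : instr (option K)) (q : nat) (h : option K -> symbol) : nat :=
  if x is Jump b n then if b h then q.+1 else n else q.+1.

Definition instr_act (x : instr (option K)) : (option K -> symbol) -> option K -> symbol * move :=
  if x is Do g then g else @stay_act _.

Definition decider_heads (r : tape_index 1 #|K| -> symbol) (o : option K) : symbol :=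
  if o is Some i then r (inr (Some (enum_rank i))) else r (inl ord0).

Definition spread (g : option K -> symbol * move) (b : bool) :
    {ffun tape_index 1 #|K| -> symbol * move} :=
  [ffun i => match i with
    | inl _ => g None
    | inr (Some j) => g (Some (enum_val j))
    | inr None => (Some b, MStay)
    end].

(* Every step writes a bit on the output tape, so that a bit is there even when
   the clock interrupts the computation; only the bit written on entering the
   halting state matters. *)
Definition decider_trans (q : 'I_len.+1) (r : {ffun tape_index 1 #|K| -> symbol}) :
    'I_len.+1 * {ffun tape_index 1 #|K| -> symbol * move} :=
  let h := decider_heads r in
  let x := odflt (Do (@stay_act _)) (onth code q) in
  let q' := minn (instr_next x q h) len in
  (inord q', spread (instr_act x h) ((q' == len) && (h (Some out) == Some true))).

Definition decider : machine 1 :=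
  @Machine 1 len.+1 #|K| ord0 (fun q => q == len :> nat) decider_trans.

Definition decider_state (t : tape_index 1 #|K| -> tape) (o : option K) : itape :=
  itape_of (if o is Some i then t (inr (Some (enum_rank i))) else t (inl ord0)).

Lemma decider_state_spread g b (t : {ffun tape_index 1 #|K| -> tape}) :
  decider_state [ffun i => tmove (spread g b i).2 (twrite (spread g b i).1 (t i))] =
  fun o => iact (g o) (decider_state t o).
Proof.
by apply: funext => -[i|]; rewrite /decider_state !ffunE ?enum_rankK iact_of.
Qed.

Lemma onth_code_lt q x : onth code q = Some x -> q < len.
Proof.
rewrite /len; elim: code q => [|y p IH] [|q] //= /IH; lia.
Qed.

(** Every program counter past the end of the code, where [code_step] idles, corresponds to the
    single halting state [len]; hence [minn]. *)
Lemma decider_step (cf : config decider) q s :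
  cf.1 = minn q len :> nat -> decider_state cf.2 = s ->
  let cf' := mstep cf in let x := code_step code (q, s) in
  cf'.1 = minn x.1 len :> nat /\ decider_state cf'.2 = x.2.
Proof.
case: cf => p t /= Ep <-; rewrite /mstep /code_step /=.
case: ifP => [/eqP p_len|p_len] /=.
  case Ex: (onth code q) => [x|] /=; last by [].
  by move: (onth_code_lt Ex) p_len; rewrite Ep; lia.
have q_lt : q < len by move: p_len; rewrite Ep; lia.
have {}Ep : p = q :> nat by rewrite Ep; lia.
have Eh : decider_heads [ffun i => tread (t i)] = heads (decider_state t).
  by apply: funext => -[i|]; rewrite /decider_heads ffunE /heads iread_of.
rewrite inordK ?ltnS ?geq_minr // Eh Ep.
rewrite decider_state_spread -/(act_state _ _).
have : onth code q <> None.
  clear -q_lt; rewrite /len in q_lt; elim: code q q_lt => [|y r IH] [|q] //= lt_q; exact: IH.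
by case: (onth code q) => [[g|b n]|] //= _; rewrite act_state_id.
Qed.

Definition bit_tape (t : tape) (b : bool) := t = Tape [::] [:: Some b].

Lemma decider_out_step (cf : config decider) :
  cf.1 != len :> nat ->
  cf.2 (inr None) = Tape [::] [::] \/ (exists b, bit_tape (cf.2 (inr None)) b) ->
  bit_tape ((mstep cf).2 (inr None))
    (((mstep cf).1 == len :> nat) && (heads (decider_state cf.2) (Some out) == Some true)).
Proof.
move=> /negPf Hl Hout; rewrite /mstep /= Hl /= !ffunE /= inordK ?ltnS ?geq_minr //.
rewrite /bit_tape /twrite /=.
rewrite [heads _ _]iread_of.
by case: Hout => [->|[b ->]] /=.
Qed.

Definition decider_init (u : seq bool) (o : option K) : itape :=
  itape_of (tape_of_str (if o is None then u else [::])).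

Lemma decider_sim T (u : seq bool) :
  let cf := iter T (@mstep _ decider) (minit decider (fun=> u)) in
  let x := iter T (code_step code) (0, decider_init u) in
  cf.1 = minn x.1 len :> nat /\ decider_state cf.2 = x.2.
Proof.
elim: T => [|T [IH1 IH2]] /=.
  rewrite min0n; split => //; apply: funext => -[i|]; rewrite /decider_state !ffunE //.
set x := iter T (code_step code) _ in IH1 IH2 *.
by have := decider_step IH1 IH2; rewrite -surjective_pairing.
Qed.

Lemma decider_out_bit T (u : seq bool) : 0 < len ->
  exists b, bit_tape ((iter T.+1 (@mstep _ decider) (minit decider (fun=> u))).2 (inr None)) b.
Proof.
move=> len_gt0; elim: T => [|T [b IH]].
  eexists; apply: decider_out_step; first by rewrite /= eq_sym -lt0n.
  by left; rewrite /minit /= ffunE.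
rewrite iterS; set cf := iter _ _ _ in IH *.
case: (boolP (cf.1 == len :> nat)) => Hl; first by exists b; rewrite /mstep /= Hl.
by eexists; apply: decider_out_step => //; right; exists b.
Qed.

Lemma bit_tape_str t b : bit_tape t b -> str_of_tape t = [:: b].
Proof. by move=> ->. Qed.

(** Membership in P asks for exactly one output bit on every input, even if the program is
    interrupted. Each step before halting leaves one bit on the output tape, and the clock allows a
    first step since [0 < E]. *)
Lemma decider_in_P E : 0 < len -> 0 < E ->
  in_P (fun u => head false (clocked_run (Clocked decider E) (fun=> u))).
Proof.
move=> len_gt0 E_gt0; exists (Clocked decider E) => u; rewrite /clocked_run [cexp _]/=.
set T := _ + E; have : 0 < T by rewrite ltn_addl.
case: T => // T _.
by have [b /bit_tape_str ->] := decider_out_bit T u len_gt0.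
Qed.

End Decider.

(** The idle instruction at the end makes the transition into the halting state read the tapes as
    [c] leaves them; the strict bound on [t] pays for it. *)
Lemma decider_run (K : finType) (c : cmd (option K)) (out : K) E (u : seq bool) t s :
  exec c (decider_init u) t s -> t < size u ^ E + E ->
  clocked_run (Clocked (decider (Seq c (Act (@stay_act _))) out) E) (fun=> u) =
  [:: heads s (Some out) == Some true].
Proof.
move=> run lt_t; set c' := Seq _ _; set M := decider c' out.
have [t' le_t /=] := exec_compile run [::] [:: Do (@stay_act _)].
rewrite -[_ ++ _]/(compile 0 c') add0n => Et.
have El : size (compile 0 c') = (size (compile 0 c)).+1 by rewrite /= size_cat addn1.
have Ek : code_step (compile 0 c') (size (compile 0 c), s) = ((size (compile 0 c)).+1, s).
  by rewrite /code_step /= onth_size /= act_state_id.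
have [] := decider_sim c' out t' u; rewrite Et => E1 E2.
have [] := decider_sim c' out t'.+1 u; rewrite [iter t'.+1 (code_step _) _]iterS Et Ek => E3 _.
rewrite /clocked_run /= big_ord1.
have halted T : (iter (T + t'.+1) (@mstep _ M) (minit M (fun=> u))) =
    iter t'.+1 (@mstep _ M) (minit M (fun=> u)).
  elim: T => // T IH; rewrite addSn iterS IH.
  apply: mstep_halt; rewrite -[mhalt _]/(_ == size (compile 0 c') :> nat) E3 El.
  by rewrite minnn.
rewrite -(subnK (leq_ltn_trans le_t lt_t)) halted.
apply: bit_tape_str.
have -> : heads s (Some out) = heads (decider_state (iter t' (@mstep _ M) (minit M (fun=> u))).2)
  (Some out).
  by rewrite E2.
have := @decider_out_step _ c' out (iter t' (@mstep _ M) (minit M (fun=> u))).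
rewrite -iterS E3 /=.
have -> : minn (size (compile 0 c)).+1 (size (compile 0 c')) == size (compile 0 c').
  by rewrite El minnn.
apply; first by rewrite E1 El /=; lia.
case: (t') => [|T]; first by left; rewrite ffunE.
by right; apply: decider_out_bit; rewrite El.
Qed.

(** * Basic programs *)

Definition cells (l r : seq symbol) : itape := itape_of (Tape l r).

Lemma iread_cells l r : iread (cells l r) = head None r.
Proof. exact: iread_of. Qed.

Lemma iact_stay a l r : iact (a, MStay) (cells l r) = cells l (a :: behead r).
Proof. exact: iact_of. Qed.

Lemma iact_right a l r : iact (a, MRight) (cells l r) = cells (a :: l) (behead r).
Proof. exact: iact_of. Qed.

Lemma iact_left a l r : 
  iact (a, MLeft) (cells l r) = cells (behead l) (head None l :: a :: behead r).
Proof. exact: iact_of. Qed.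

Lemma cells_blank_left : cells [:: None] =1 cells [::].
Proof. by move=> r; have := itape_of_blank [::] r 1 0; rewrite /= cats0. Qed.

Lemma cells_rcons_blank l r : cells l (rcons r None) = cells l r.
Proof. by have := itape_of_blank l r 0 1; rewrite /= cats0 cats1. Qed.

Lemma cells_blank_right l : cells l [:: None] = cells l [::].
Proof. exact: (cells_rcons_blank l [::]). Qed.

Lemma keep_left l r : iact (head None r, MLeft) (cells l r) = cells (behead l) (head None l :: r).
Proof.
rewrite iact_left; case: r => //=.
exact: (cells_rcons_blank _ [:: head None l]).
Qed.

Lemma keep_right l r : iact (head None r, MRight) (cells l r) = cells (head None r :: l) (behead r).
Proof. exact: iact_right. Qed.

Definition str_cells (s : seq bool) : itape := cells [::] (map Some s).

Section Programs.

Variable K : eqType.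
Implicit Types (i j : K) (s : K -> itape) (T : itape).

Definition upd s i T : K -> itape := fun j => if j == i then T else s j.

Lemma upd_same s i T : upd s i T i = T.
Proof. by rewrite /upd eqxx. Qed.

Lemma upd_other s i T j : j != i -> upd s i T j = s j.
Proof. by rewrite /upd => /negPf ->. Qed.

Lemma upd_id s i : upd s i (s i) = s.
Proof. by apply: funext => j; rewrite /upd; case: eqP => // ->. Qed.

Lemma upd_upd s i T T' : upd (upd s i T) i T' = upd s i T'.
Proof. by apply: funext => j; rewrite /upd; case: eqP. Qed.

Lemma updC s i j T T' : i != j -> upd (upd s i T) j T' = upd (upd s j T') i T.
Proof.
move=> /eqP neq; apply: funext => k; rewrite /upd.
by case: eqP => // ->; case: eqP => // /esym.
Qed.

Definition act1 i (f : (K -> symbol) -> symbol * move) : cmd K :=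
  Act (fun h j => if j == i then f h else (h j, MStay)).

Lemma exec_act1 s i f T :
  iact (f (heads s)) (s i) = T -> exec (act1 i f) s 1 (upd s i T).
Proof.
move=> <-; set s' := upd _ _ _.
have -> : s' = act_state (fun h j => if j == i then f h else (h j, MStay)) s.
  apply: funext => j; rewrite /s' /upd /act_state; case: eqP => [->|_] //.
  by rewrite iact_id.
exact: ExAct.
Qed.

Definition keep i (d : move) : cmd K := act1 i (fun h => (h i, d)).

Lemma exec_keep_left s i l r : s i = cells l r ->
  exec (keep i MLeft) s 1 (upd s i (cells (behead l) (head None l :: r))).
Proof. by move=> Es; apply: exec_act1; rewrite /heads Es iread_cells keep_left. Qed.

Lemma exec_keep_right s i l r : s i = cells l r ->
  exec (keep i MRight) s 1 (upd s i (cells (head None r :: l) (behead r))).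
Proof. by move=> Es; apply: exec_act1; rewrite /heads Es iread_cells keep_right. Qed.

Definition rewind i : cmd K :=
  Seq (keep i MLeft) (Seq (While (fun h => h i != None) (keep i MLeft)) (keep i MRight)).

Lemma exec_rewind s i (l : seq bool) r : s i = cells (map Some l) r ->
  exec (rewind i) s (4 * size l + 4) (upd s i (cells [::] (map Some (rev l) ++ r))).
Proof.
move=> Es; pose s1 l r := upd s i (cells (behead l) (head None l :: r)).
have loop : forall l r, exec (While (fun h => h i != None) (keep i MLeft))
     (s1 (map Some l) r) (3 * size l + 1) (upd s i (cells [::] (None :: map Some (rev l) ++ r))).
  elim=> {Es l r} [|b l IHl] r.
    by apply: ExStop; rewrite /heads /s1 upd_same iread_cells.
  apply: (@ExLe _ _ _ _ (1 + (3 * size l + 1) + 2)); last by rewrite /=; lia.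
  apply: (@ExLoop _ _ _ _ (s1 (map Some l) (Some b :: r))).
  - by rewrite /heads /s1 upd_same iread_cells.
  - have := @exec_keep_left (s1 (map Some (b :: l)) r) i (map Some l) (Some b :: r).
    by rewrite /s1 upd_same upd_upd; apply.
  - by have := IHl (Some b :: r); rewrite rev_cons map_rcons cat_rcons.
apply: (@ExLe _ _ _ _ (1 + ((3 * size l + 1) + 1))); last lia.
apply: ExSeq (exec_keep_left Es) _; apply: ExSeq (loop _ _) _.
have := @exec_keep_right (upd s i (cells [::] (None :: map Some (rev l) ++ r))) i [::]
  (None :: map Some (rev l) ++ r).
by rewrite upd_same upd_upd cells_blank_left; apply.
Qed.

Definition copy i j : cmd K :=
  Seq (While (fun h => h i != None)
         (Seq (act1 j (fun h => (h i, MRight))) (keep i MRight)))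
      (rewind j).

Lemma exec_copy s i j l (v : seq bool) q :
  i != j -> s i = cells l (map Some v ++ q) -> head None q = None -> s j = cells [::] [::] ->
  exists T, exec (copy i j) s (8 * size v + 5) (upd (upd s i T) j (str_cells v)).
Proof.
move=> neq_ij Ei Eq Ej.
have loop : forall v l w s, s i = cells l (map Some v ++ q) -> s j = cells (map Some w) [::] ->
    exists T, exec (While (fun h => h i != None)
         (Seq (act1 j (fun h => (h i, MRight))) (keep i MRight))) s (4 * size v + 1)
      (upd (upd s i T) j (cells (map Some (catrev v w)) [::])).
  elim=> {Ei Ej l v s} [|b v IHv] l w s Ei Ej.
    exists (s i); rewrite upd_id /= -Ej upd_id; apply: ExStop.
    by rewrite /heads Ei iread_cells /= Eq.
  pose s1 := upd s j (cells (Some b :: map Some w) [::]).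
  pose s2 := upd s1 i (cells (Some b :: l) (map Some v ++ q)).
  have [] := IHv (Some b :: l) (b :: w) s2.
  - by rewrite /s2 upd_same.
  - by rewrite /s2 upd_other 1?eq_sym // /s1 upd_same.
  move=> T Hr; exists T.
  apply: (@ExLe _ _ _ _ ((1 + 1) + (4 * size v + 1) + 2)); last by rewrite /=; lia.
  apply: (@ExLoop _ _ _ _ s2).
  - by rewrite /heads Ei iread_cells.
  - apply: (@ExSeq _ _ _ _ s1); first by apply: exec_act1;
      rewrite /heads Ei Ej iread_cells iact_right.
    by apply: (@exec_keep_right _ _ l (Some b :: map Some v ++ q)); rewrite /s1 upd_other.
  - suff -> : upd (upd s i T) j (cells (map Some (catrev (b :: v) w)) [::]) =
        upd (upd s2 i T) j (cells (map Some (catrev v (b :: w))) [::]) by [].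
    by rewrite /s2 upd_upd /s1 (@updC _ j i) 1?eq_sym // upd_upd.
have [T HT] := loop v l [::] s Ei Ej; exists T.
apply: (@ExLe _ _ _ _ ((4 * size v + 1) + (4 * size v + 4))); last lia.
apply: ExSeq HT _; set s1 := upd _ _ _.
have := @exec_rewind s1 j (rev v) [::]; rewrite /s1 upd_same size_rev revK cats0 => /(_ erefl).
by rewrite upd_upd.
Qed.

(** The borrow of a binary decrement: zeros become ones up to the first one, which [repeat] then
    clears. If the number is zero, the head runs to the blank and the loop of [repeat] ends. *)
Definition scan i : cmd K :=
  While (fun h => h i == Some false) (act1 i (fun=> (Some true, MRight))).

(* [i] holds a number in binary, least significant bit first, in front of which
   the tape is blank; it is the number of times that [c] is executed. *)
Definition repeat i (c : cmd K) : cmd K :=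
  Seq (scan i) (While (fun h => h i == Some true)
    (Seq (act1 i (fun=> (Some false, MStay))) (Seq (rewind i) (Seq c (scan i))))).

Lemma exec_scan0 s i l v : s i = cells l (map Some v) -> bin_nat v = 0 ->
  exists l', exec (scan i) s (3 * size v + 1) (upd s i (cells l' [::])).
Proof.
elim: v l s => [|b v IHv] l s Es.
  by exists l; rewrite -[cells l _]Es upd_id; apply: ExStop; rewrite /heads Es iread_cells.
case: b Es => //= Es v0; have {v0} v0 : bin_nat v = 0 by lia.
pose s1 := upd s i (cells (Some true :: l) (map Some v)).
have [|l' Hr] := IHv (Some true :: l) s1 _ v0; first by rewrite /s1 upd_same.
exists l'; apply: (@ExLe _ _ _ _ (1 + (3 * size v + 1) + 2)); last lia.
apply: (@ExLoop _ _ _ _ s1).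
- by rewrite /heads Es iread_cells.
- by apply: exec_act1; rewrite Es iact_right.
- by move: Hr; rewrite upd_upd.
Qed.

Lemma exec_scan s i (v : seq bool) : s i = str_cells v -> 0 < bin_nat v ->
  exists k w, exec (scan i) s (3 * size v + 1)
      (upd s i (cells (nseq k (Some true)) (Some true :: map Some w))) /\
    k + size w < size v /\ bin_nat (nseq k true ++ false :: w) = (bin_nat v).-1.
Proof.
move=> Es v_gt0.
have gen : forall v l s, 0 < bin_nat v -> s i = cells l (map Some v) ->
    exists k w, exec (scan i) s (3 * size v + 1)
      (upd s i (cells (nseq k (Some true) ++ l) (Some true :: map Some w))) /\
    k + size w < size v /\ bin_nat (nseq k true ++ false :: w) = (bin_nat v).-1.
  elim=> {v v_gt0 s Es} // b v IHv l s /= v_gt0 Es; case: b Es v_gt0 => /= Es v_gt0.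
    exists 0, v; split; last by split.
    rewrite -[cells _ _]Es upd_id; apply: (@ExLe _ _ _ _ 1); last lia.
    by apply: ExStop; rewrite /heads Es iread_cells.
  pose s1 := upd s i (cells (Some true :: l) (map Some v)).
  have v_gt : 0 < bin_nat v by lia.
  have [|k [w [Hr [le_kw Ew]]]] := IHv (Some true :: l) s1 v_gt; first by rewrite /s1 upd_same.
  exists k.+1, w; split; last first.
    split; first by lia.
    by rewrite /= Ew; lia.
  apply: (@ExLe _ _ _ _ (1 + (3 * size v + 1) + 2)); last lia.
  apply: (@ExLoop _ _ _ _ s1).
  - by rewrite /heads Es iread_cells.
  - by apply: exec_act1; rewrite Es iact_right.
  - by move: Hr; rewrite upd_upd -[k.+1]addn1 nseqD -catA.
by have [k [w]] := gen v [::] s v_gt0 Es; rewrite cats0 => ?; exists k, w.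
Qed.

(** The arbitrary content [T] expresses that [c] leaves the counter tape as it finds it. Besides
    [t], a round costs a rewind of 4 and a scan of 3 steps per digit, up to a constant. *)
Lemma exec_repeat i c (v : seq bool) (s : nat -> K -> itape) t :
  (forall n T, n < bin_nat v -> exec c (upd (s n) i T) t (upd (s n.+1) i T)) ->
  exists T, exec (repeat i c) (upd (s 0) i (str_cells v))
    ((bin_nat v).+1 * (t + 7 * size v + 10)) (upd (s (bin_nat v)) i T).
Proof.
set W := While (fun h => h i == Some true)
  (Seq (act1 i (fun=> (Some false, MStay))) (Seq (rewind i) (Seq c (scan i)))).
move=> Hc; have [m Em] : exists m, size v = m by exists (size v).
(* The execution is cut after the first scan: the scan that opens the remaining [N] rounds is the
   last command of the loop body of the current round. *)
have loop : forall N v (s : nat -> K -> itape), bin_nat v = N -> size v <= m ->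
    (forall n T, n < N -> exec c (upd (s n) i T) t (upd (s n.+1) i T)) ->
    exists T s1, exec (scan i) (upd (s 0) i (str_cells v)) (3 * m + 1) s1 /\
      exec W s1 (N * (t + 7 * m + 8) + 1) (upd (s N) i T).
  clear Hc Em v s; elim=> [|N IHN] v s Ev le_m Hc.
    have [|l Hl] := exec_scan0 (s := upd (s 0) i (str_cells v)) (i := i) (l := [::]) _ Ev.
      by rewrite upd_same.
    exists (cells l [::]), (upd (s 0) i (cells l [::])); split.
      by apply: (@ExLe _ _ _ _ (3 * size v + 1)); [move: Hl; rewrite upd_upd | lia].
    by apply: ExStop; rewrite /heads upd_same iread_cells.
  have [||k [w [Hr [le_kw Ew]]]] := exec_scan (s := upd (s 0) i (str_cells v)) (i := i) (v := v).
  - by rewrite upd_same.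
  - by rewrite Ev.
  rewrite upd_upd in Hr; rewrite Ev /= in Ew.
  have [||T [s1 [H1 H2]]] := IHN _ (fun n => s n.+1) Ew.
  - by rewrite size_cat size_nseq /=; lia.
  - by move=> n T lt_n; apply: Hc.
  exists T; eexists; split; first by apply: ExLe Hr _; lia.
  apply: (@ExLe _ _ _ _ ((1 + (4 * m + 4 + (t + (3 * m + 1)))) + (N * (t + 7 * m + 8) + 1) + 2));
    last nia.
  apply: (@ExLoop _ _ _ _ s1) H2; first by rewrite /heads upd_same iread_cells.
  set A := (X in exec _ X).
  apply: (@ExSeq _ _ _ _ (upd (s 0) i (cells (nseq k (Some true)) (Some false :: map Some w)))).
    have := @exec_act1 A i (fun=> (Some false, MStay));
      rewrite /A upd_same iact_stay => /(_ _ erefl).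
    by rewrite upd_upd.
  apply: (@ExSeq _ _ _ _ (upd (s 0) i (str_cells (nseq k true ++ false :: w)))).
    have := @exec_rewind (upd (s 0) i (cells (nseq k (Some true)) (Some false :: map Some w))) i
      (nseq k true)
       (map Some (false :: w)).
    rewrite upd_same map_nseq upd_upd => /(_ erefl) H; apply: (ExLe _ (t := 4 * k + 4)); last lia.
    move: H; rewrite size_nseq -map_cat; congr (exec _ _ _ (upd _ _ (cells _ (map _ (_ ++ _))))).
    by elim: (k) => // n IH; rewrite /= rev_cons IH -cats1 -[[:: true]]/(nseq 1 true) -nseqD addn1.
  apply: (@ExSeq _ _ _ _ (upd (s 1) i (str_cells (nseq k true ++ false :: w)))); last exact: H1.
  exact: Hc.
have [|T [s1 [H1 H2]]] := loop _ _ s erefl _ Hc; first by rewrite Em.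
by exists T; apply: ExLe (ExSeq H1 H2) _; rewrite Em; nia.
Qed.

End Programs.

(** * Running a program on some of the tapes *)

Section Lift.

Variables (K : finType) (L : eqType) (f : K -> L).
Hypothesis f_inj : injective f.

Definition overlay (T : Type) (s : L -> T) (r : K -> T) (j : L) : T :=
  if [pick i | f i == j] is Some i then r i else s j.

Fixpoint lift_cmd (c : cmd K) : cmd L :=
  match c with
  | Act g => Act (fun h => overlay (@stay_act _ h) (g (fun i => h (f i))))
  | Seq c1 c2 => Seq (lift_cmd c1) (lift_cmd c2)
  | While b c => While (fun h => b (fun i => h (f i))) (lift_cmd c)
  end.

Lemma overlay_in (T : Type) (s : L -> T) r i : overlay s r (f i) = r i.
Proof. by rewrite /overlay; case: pickP => [j /eqP/f_inj ->|/(_ i)/eqP]. Qed.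

Lemma overlay_out (T : Type) (s : L -> T) r j : (forall i, f i != j) -> overlay s r j = s j.
Proof. by rewrite /overlay; case: pickP => // i /eqP <- /(_ i)/eqP. Qed.

Lemma overlay_id (T : Type) (s : L -> T) : overlay s (fun i => s (f i)) = s.
Proof. by apply: funext => j; rewrite /overlay; case: pickP => // i /eqP ->. Qed.

Lemma exec_lift c r t r' s :
  exec c r t r' -> exec (lift_cmd c) (overlay s r) t (overlay s r').
Proof.
have hf r0 : (fun i => heads (overlay s r0) (f i)) = heads r0.
  by apply: funext => i; rewrite /heads overlay_in.
elim=> {c r t r'} /= [g r|c1 c2 r r1 r2 t1 t2 _ H1 _ H2|b c r nb|b c r r1 r2 t1 t2 br _ H1 _ H2|
    c r r' t t' _ H le_t].
- set g' := fun h => _; suff -> : overlay s (act_state g r) = act_state g' (overlay s r) by exact: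
    ExAct.
  apply: funext => j; rewrite /act_state /g' hf /overlay.
  by case: pickP => // nj; rewrite /stay_act /heads /overlay; case: pickP => [i|_];
    rewrite ?nj ?iact_id.
- exact: ExSeq H1 H2.
- by apply: ExStop; rewrite hf.
- by apply: ExLoop H1 H2; rewrite hf.
- exact: ExLe H le_t.
Qed.

End Lift.

(** A self-delimiting code, so that several strings fit on one tape: [true] announces a further bit,
    [false] the end. For [v] of known length, each position is either a constant or one bit of [v],
    which suits hardwiring. *)
Fixpoint enc (v : seq bool) : seq bool :=
  if v is b :: v' then true :: b :: enc v' else [:: false].

Lemma size_enc v : size (enc v) = (size v).*2.+1.
Proof. by elim: v => //= b v ->; rewrite doubleS. Qed.

Section Parse.

Variables (K : eqType) (p : K).

(** The bits are pushed in front of tape [j], so that its head ends on the first cell. The string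
    comes out reversed, which [enc_all] compensates. *)
Definition parse_tape (j : K) : cmd K :=
  Seq (While (fun h => h p == Some true)
        (Seq (keep p MRight)
          (Seq (keep j MLeft) (Seq (act1 j (fun h => (h p, MStay))) (keep p MRight)))))
      (keep p MRight).

Lemma exec_parse s j l v w q : p != j ->
  s p = cells l (map Some (enc v ++ q)) -> s j = str_cells w ->
  exists l', exec (parse_tape j) s (6 * size v + 2)
    (upd (upd s p (cells l' (map Some q))) j (str_cells (catrev v w))).
Proof.
move=> neq_pj; rewrite /parse_tape; set W := While _ _.
have Wloop : forall v w l s, s p = cells l (map Some (enc v ++ q)) -> s j = str_cells w ->
    exists l', exec W s (6 * size v + 1)
      (upd (upd s p (cells l' (map Some (false :: q)))) j (str_cells (catrev v w))).
  elim=> {v w l s} [|b v IHv] w l s Ep Ej.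
    exists l; rewrite -[cells l _]Ep upd_id -[str_cells _]Ej upd_id.
    by apply: ExStop; rewrite /heads Ep iread_cells.
  pose s1 := upd s p (cells (Some true :: l) (map Some (b :: enc v ++ q))).
  pose s2 := upd s1 j (cells [::] (None :: map Some w)).
  pose s3 := upd s1 j (str_cells (b :: w)).
  pose s4 := upd s3 p (cells (Some b :: Some true :: l) (map Some (enc v ++ q))).
  have E4 X Y : upd (upd s4 p X) j Y = upd (upd s p X) j Y.
    by rewrite /s4 upd_upd /s3 (@updC _ _ j p) 1?eq_sym // upd_upd /s1 upd_upd.
  have [||l' Hl] := IHv (b :: w) (Some b :: Some true :: l) s4.
  - by rewrite /s4 upd_same.
  - by rewrite /s4 upd_other 1?eq_sym // /s3 upd_same.
  exists l'; rewrite E4 in Hl.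
  apply: (@ExLe _ _ _ _ ((1 + (1 + (1 + 1))) + (6 * size v + 1) + 2)); last by rewrite /=; lia.
  apply: (@ExLoop _ _ _ _ s4) Hl; first by rewrite /heads Ep iread_cells.
  apply: (@ExSeq _ _ _ _ s1).
    exact: (@exec_keep_right _ _ _ l (map Some (true :: b :: enc v ++ q))).
  apply: (@ExSeq _ _ _ _ s2).
    by apply: (@exec_keep_left _ _ _ [::] (map Some w)); rewrite /s1 upd_other // eq_sym.
  apply: (@ExSeq _ _ _ _ s3).
    rewrite (_ : s3 = upd s2 j (str_cells (b :: w))); last by rewrite /s2 upd_upd.
    apply: exec_act1; rewrite /heads /s2 upd_same upd_other // /s1 upd_same.
    by rewrite iread_cells iact_stay.
  apply: (@exec_keep_right _ _ _ (Some true :: l) (map Some (b :: enc v ++ q))).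
  by rewrite /s3 upd_other // /s1 upd_same.
move=> Ep Ej; have [l' Hl] := Wloop _ _ _ _ Ep Ej; exists (Some false :: l').
apply: (@ExLe _ _ _ _ ((6 * size v + 1) + 1)); last lia.
apply: ExSeq Hl _; set s' := upd _ _ _.
have := @exec_keep_right _ s' p l' (map Some (false :: q)).
rewrite /s' upd_other // upd_same => /(_ erefl).
by rewrite (@updC _ _ j p) 1?eq_sym // upd_upd.
Qed.

Definition nop : cmd K := Act (@stay_act _).

Lemma exec_nop s : exec nop s 1 s.
Proof. by rewrite -{2}(act_state_id s); apply: ExAct. Qed.

Definition seqs (T : Type) (c : T -> cmd K) (js : seq T) : cmd K :=
  foldr (fun j => Seq (c j)) nop js.

Definition enc_all (T : Type) (a : T -> seq bool) (js : seq T) : seq bool :=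
  flatten [seq enc (rev (a j)) | j <- js].

Lemma exec_parse_all (a : K -> seq bool) js s l q : uniq (p :: js) ->
  s p = cells l (map Some (enc_all a js ++ q)) ->
  (forall j, j \in js -> s j = str_cells [::]) ->
  exists l', exec (seqs parse_tape js) s (3 * size (enc_all a js) + 1)
    (upd (fun j => if j \in js then str_cells (a j) else s j) p (cells l' (map Some q))).
Proof.
elim: js l s => [|j js IH] l s /=.
  by move=> _ Ep _; exists l; rewrite -[cells l _]Ep; set f := fun _ => _;
    rewrite (_ : f = s) ?upd_id; [apply: exec_nop | apply: funext].
rewrite inE negb_or -!andbA => /and4P[neq_pj p_js j_js u_js] Ep Ejs.
have Ej : s j = str_cells [::] by apply: Ejs; rewrite mem_head.
have Ep' : s p = cells l (map Some (enc (rev (a j)) ++ enc_all a js ++ q)) by rewrite Ep catA.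
have [l1 H1] := exec_parse neq_pj Ep' Ej.
set s1 := upd _ _ _ in H1.
have [|||l2 H2] := IH l1 s1.
- by rewrite /= p_js.
- by rewrite /s1 upd_other // upd_same.
- move=> i i_js; rewrite /s1 !upd_other ?Ejs ?inE ?i_js ?orbT //.
    by apply: contraNneq p_js => <-.
  by apply: contraNneq j_js => <-.
exists l2; apply: (@ExLe _ _ _ _ (6 * size (rev (a j)) + 2 + (3 * size (enc_all a js) + 1)));
  last first.
  by rewrite /enc_all /= size_cat size_enc; lia.
apply: ExSeq H1 _.
suff -> : upd (fun i => if i \in j :: js then str_cells (a i) else s i) p (cells l2 (map Some q)) =
     upd (fun i => if i \in js then str_cells (a i) else s1 i) p (cells l2 (map Some q)) by exact:
       H2.
apply: funext => i; rewrite /upd; case: eqP => // /eqP neq_ip; rewrite inE /s1 /upd.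
rewrite (negPf neq_ip); case: (eqVneq i j) => [->|_] /=; last by [].
by rewrite (negPf j_js) -/(rev _) revK.
Qed.

End Parse.

(** * Growth rates *)

Notation eventual P := (eventually (P : nat -> Prop)).

Lemma eventual_ge n : eventual (fun k => n <= k).
Proof. by exists n. Qed.

(** In terms of [m = 2 ^ k] this is growth m^o(1), and [polyb] is growth m^O(1). Integer quotients
    replace the real exponents. *)
Definition subpoly (h : nat -> nat) : Prop :=
  forall q, 0 < q -> eventual (fun k => h k <= 2 ^ (k %/ q)).

Definition polyb (h : nat -> nat) : Prop :=
  exists e, eventual (fun k => h k <= 2 ^ (e * k)).

Lemma subpoly_le h1 h2 : eventual (fun k => h1 k <= h2 k) -> subpoly h2 -> subpoly h1.
Proof. by move=> le12 sh q /sh; apply: filterS2 le12 => k; apply: leq_trans. Qed.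

Lemma subpoly_const c : subpoly (fun=> c).
Proof.
move=> q q_gt0; apply: filterS (eventual_ge (c * q)) => k; rewrite -leq_divRL // => le_c.
by apply: leq_trans (ltnW (ltn_expl c (isT : 1 < 2))) _; rewrite leq_exp2l.
Qed.

Lemma subpolyM h1 h2 : subpoly h1 -> subpoly h2 -> subpoly (fun k => h1 k * h2 k).
Proof.
move=> s1 s2 q q_gt0; have q2 : 0 < q * 2 by lia.
apply: filterS2 (s1 _ q2) (s2 _ q2) => k l1 l2.
apply: leq_trans (leq_mul l1 l2) _; rewrite -expnD leq_exp2l //.
by rewrite divnMA; have := leq_divM (k %/ q) 2; lia.
Qed.

Lemma subpolyD h1 h2 : subpoly h1 -> subpoly h2 -> subpoly (fun k => h1 k + h2 k).
Proof.
move=> s1 s2 q q_gt0; have q2 : 0 < q * 2 by lia.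
apply: filterS3 (s1 _ q2) (s2 _ q2) (eventual_ge (q * 2)) => k l1 l2 le_k.
apply: leq_trans (leq_add l1 l2) _; rewrite addnn -mul2n -expnS leq_exp2l //.
rewrite divnMA in l1 l2 *; have := leq_divM (k %/ q) 2.
have : 1 <= k %/ q %/ 2 by rewrite -divnMA divn_gt0.
lia.
Qed.

Lemma subpoly_id : subpoly id.
Proof.
(* For [n = k %/ q] one gets [k <= 2 ^ (q + 1 + n %/ 2)], and the threshold makes this exponent at
   most [n]. *)
move=> q q_gt0; apply: filterS (eventual_ge (q * (2 * q + 4))) => k le_k.
have lt_k : k < q * (k %/ q).+1 by rewrite mulnC; exact: ltn_ceil.
set n := k %/ q in lt_k *.
have le_n : 2 * q + 4 <= n by rewrite /n leq_divRL // mulnC.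
have l1 : q <= 2 ^ q by apply/ltnW/ltn_expl.
have l2 : n %/ 2 < 2 ^ (n %/ 2) by apply: ltn_expl.
have l3 : n < 2 * (n %/ 2).+1 by rewrite mulnC; exact: ltn_ceil.
apply: leq_trans (ltnW lt_k) _.
apply: (@leq_trans (2 ^ q * (2 * 2 ^ (n %/ 2)))); first by apply: leq_mul => //; lia.
rewrite -expnS -expnD leq_exp2l //.
by have := leq_divM n 2; lia.
Qed.

Lemma subpoly_sum (I : finType) (h : I -> nat -> nat) :
  (forall i, subpoly (h i)) -> subpoly (fun k => \sum_i h i k).
Proof.
move=> sh; elim: (index_enum I) => [|i r IH].
  by apply: subpoly_le (subpoly_const 0); apply: filterE => k; rewrite big_nil.
by apply: subpoly_le (subpolyD (sh i) IH); apply: filterE => k; rewrite big_cons.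
Qed.

Lemma polyb_le h1 h2 : eventual (fun k => h1 k <= h2 k) -> polyb h2 -> polyb h1.
Proof.
by move=> le12 [e ph]; exists e; apply: filterS2 le12 ph => k; apply: leq_trans.
Qed.

Lemma polyb_sub h : subpoly h -> polyb h.
Proof. by move=> /(_ 1 isT) sh; exists 1; apply: filterS sh => k; rewrite divn1 mul1n. Qed.

Lemma polyb_exp : polyb (fun k => 2 ^ k).
Proof. by exists 1; apply: filterE => k; rewrite mul1n. Qed.

Lemma polyb_const c : polyb (fun=> c).
Proof. exact/polyb_sub/subpoly_const. Qed.

Lemma polybM h1 h2 : polyb h1 -> polyb h2 -> polyb (fun k => h1 k * h2 k).
Proof.
move=> [e1 p1] [e2 p2]; exists (e1 + e2); apply: filterS2 p1 p2 => k l1 l2.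
by rewrite mulnDl expnD leq_mul.
Qed.

Lemma polybD h1 h2 : polyb h1 -> polyb h2 -> polyb (fun k => h1 k + h2 k).
Proof.
move=> [e1 p1] [e2 p2]; exists (e1 + e2).+1; apply: filterS3 p1 p2 (eventual_ge 1) => k l1 l2 k_gt0.
apply: leq_trans (leq_add l1 l2) _; rewrite mulSn expnD mulnDl.
apply: (@leq_trans (2 * 2 ^ (e1 * k + e2 * k))).
  by rewrite mul2n -addnn; apply: leq_add; rewrite leq_exp2l //; lia.
by rewrite leq_mul // (@leq_pexp2l 2 1).
Qed.

Lemma polyb_sum (I : finType) (h : I -> nat -> nat) :
  (forall i, polyb (h i)) -> polyb (fun k => \sum_i h i k).
Proof.
move=> sh; elim: (index_enum I) => [|i r IH].
  by apply: polyb_le (polyb_const 0); apply: filterE => k; rewrite big_nil.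
by apply: polyb_le (polybD (sh i) IH); apply: filterE => k; rewrite big_cons.
Qed.

Lemma polybX h n : polyb h -> polyb (fun k => h k ^ n).
Proof.
move=> sh; elim: n => [|n IH]; first exact: polyb_const.
by apply: polyb_le (polybM sh IH); apply: filterE => k; rewrite expnS.
Qed.

Fixpoint bits (w n : nat) : seq bool := if w is w'.+1 then odd n :: bits w' n./2 else [::].

Lemma size_bits w n : size (bits w n) = w.
Proof. by elim: w n => //= w IH n; rewrite IH. Qed.

Lemma bin_nat_bits w n : n < 2 ^ w -> bin_nat (bits w n) = n.
Proof.
elim: w n => [|w IH] n /=; first by case: n.
rewrite expnS => lt_n; rewrite IH ?odd_double_half //; lia.
Qed.

(** Loop bounds of size 2^O(k) have O(k) digits, short enough to be part of the advice. *)
Lemma polyb_bits h : polyb h ->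
  exists v : nat -> seq bool, subpoly (fun k => size (v k)) /\
    eventual (fun k => bin_nat (v k) = h k).
Proof.
move=> [e ph]; exists (fun k => bits (e * k).+1 (h k)); split.
  apply: subpoly_le (subpolyD (subpoly_const 1) (subpolyM (subpoly_const e) subpoly_id)).
  by apply: filterE => k; rewrite size_bits add1n.
apply: filterS ph => k l1; rewrite bin_nat_bits // expnS.
have := expn_gt0 2 (e * k); lia.
Qed.

(** * Circuits *)

Lemma wires_cat ws C1 C2 : wires ws (C1 ++ C2) = wires (wires ws C1) C2.
Proof. by elim: C1 ws => //= g C1 IH ws; rewrite IH. Qed.

Lemma size_wires ws C : size (wires ws C) = size ws + size C.
Proof. by elim: C ws => [|g C IH] ws /=; rewrite ?addn0 // IH size_rcons addSnnS. Qed.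

Lemma circuit_wf_cat n C1 C2 :
  circuit_wf n (C1 ++ C2) = circuit_wf n C1 && circuit_wf (n + size C1) C2.
Proof. by elim: C1 n => [|g C1 IH] n /=; rewrite ?addn0 // IH -andbA addSnnS. Qed.

Definition gate_map (r : nat -> nat) (g : gate) : gate :=
  match g with
  | GNot i => GNot (r i)
  | GAnd i j => GAnd (r i) (r j)
  | GOr i j => GOr (r i) (r j)
  end.

Lemma gate_map_val r ws ws' n g : gate_wf n g ->
  (forall p, p < n -> nth false ws p = nth false ws' (r p)) ->
  gate_val ws' (gate_map r g) = gate_val ws g.
Proof. by case: g => [i|i j|i j] /= H Hr; [|case/andP: H => ? ?..]; rewrite !Hr. Qed.

(** * Hardwiring inputs of a circuit *)

Section Restrict.

Variables (l k : nat) (f : nat -> nat + bool).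
Hypothesis k_gt0 : 0 < k.
Hypothesis f_lt : forall p i, f p = inl i -> i < k.

(** The new wires are the [k] inputs, the three of [const_gates], then the old gates; [k + b.+1]
    carries the constant [b]. *)
Definition restrict_wire (p : nat) : nat :=
  if p < l then match f p with inl i => i | inr b => k + b.+1 end else k + 3 + (p - l).

(** The basis has no constants. Input 0, which exists as [0 < k], and its negation give false on
    wire [k + 1] and true on wire [k + 2]. *)
Definition const_gates : circuit := [:: GNot 0; GAnd 0 k; GOr 0 k].

Lemma restrict_wire_lt n p : l <= n -> p < n -> restrict_wire p < k + 3 + (n - l).
Proof.
rewrite /restrict_wire => le_n lt_p; case: (ltnP p l) => le_p; last lia.
by case E: (f p) => [i|[]] /=; [have := f_lt E| |]; lia.
Qed.

Lemma restrict_wf C n : l <= n -> circuit_wf n C ->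
  circuit_wf (k + 3 + (n - l)) (map (gate_map restrict_wire) C).
Proof.
elim: C n => //= g C IH n le_n /andP[wf_g wf_C]; rewrite -addnS -subSn //.
rewrite IH ?andbT //; last by rewrite ltnW // ltnS.
by case: g wf_g => [i|i j|i j] /=; [move=> ?|case/andP=> ? ?..]; rewrite !restrict_wire_lt.
Qed.

Lemma restrict_wires C ws ws' : l <= size ws -> circuit_wf (size ws) C ->
  size ws' = k + 3 + (size ws - l) ->
  (forall p, p < size ws -> nth false ws p = nth false ws' (restrict_wire p)) ->
  forall p, p < size ws + size C ->
    nth false (wires ws C) p =
    nth false (wires ws' (map (gate_map restrict_wire) C)) (restrict_wire p).
Proof.
elim: C ws ws' => [|g C IH] ws ws' le_l /=; first by rewrite addn0.
move=> /andP[wf_g wf_C] Es Hw p lt_p.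
rewrite (gate_map_val wf_g Hw); apply: IH; rewrite ?size_rcons; last by rewrite addSnnS.
- exact: ltnW.
- by [].
- lia.
move=> q; rewrite ltnS leq_eqVlt => /orP[/eqP->|lt_q].
  rewrite nth_rcons ltnn eqxx /restrict_wire ltnNge le_l /= -Es.
  by rewrite nth_rcons ltnn eqxx.
by rewrite !nth_rcons lt_q Es restrict_wire_lt // Hw.
Qed.

Lemma circuit_restrict C : 0 < l -> circuit_wf l C ->
  exists C', [/\ circuit_wf k C', size C' = size C + 4 &
    forall u u', size u = k -> size u' = l ->
      (forall p, p < l ->
        nth false u' p = match f p with inl i => nth false u i | inr b => b end) ->
      circuit_eval C' u = circuit_eval C u'].
Proof.
move=> l_gt0 wf_C; set o := restrict_wire (l + size C).-1.
(* The gate [GOr o o] copies the image of the old output to the last wire. This matters when [C] has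
   no gates, so that its output is an input, possibly a hardwired one. *)
exists (const_gates ++ map (gate_map restrict_wire) C ++ [:: GOr o o]); split.
- rewrite !circuit_wf_cat /= k_gt0 ltnSn /= size_map.
  have := @restrict_wf C l (leqnn _) wf_C; rewrite subnn addn0 => ->.
  have := @restrict_wire_lt (l + size C) (l + size C).-1 (leq_addr _ _).
  by rewrite addKn andbb ltn_predL addn_gt0 l_gt0 => /(_ isT) ->; rewrite !andbT; lia.
- by rewrite !size_cat size_map /=; lia.
move=> u u' Eu Eu' Hf; rewrite /circuit_eval !wires_cat.
have -> : wires u const_gates = u ++ [:: ~~ nth false u 0; false; true].
  rewrite /= -!cats1 -!catA !nth_cat Eu k_gt0 ltnn subnn /=.
  by case: (nth _ _ _).
set ws' := u ++ _; rewrite /= last_rcons orbb.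
rewrite -[RHS]nth_last size_wires Eu'; apply/esym/restrict_wires.
- by rewrite Eu'.
- by rewrite Eu'.
- by rewrite Eu' subnn addn0 size_cat Eu.
- rewrite Eu' => p lt_p; rewrite Hf // /restrict_wire lt_p.
  rewrite nth_cat Eu; case E: (f p) => [i|b]; first by rewrite (f_lt E).
  by rewrite ltnNge leq_addr /= addKn; case: b {E}.
by rewrite Eu' prednK // addn_gt0 l_gt0.
Qed.

End Restrict.

(** * Truth tables and codes of circuits *)

Lemma bin_nat_rcons v b : bin_nat (rcons v b) = bin_nat v + b * 2 ^ size v.
Proof. by elim: v => [|a v IH] /=; rewrite ?muln1 ?addn0 // IH expnS; lia. Qed.

Lemma bin_nat_lt v : bin_nat v < 2 ^ size v.
Proof. by elim: v => //= b v IH; rewrite expnS; case: b => /=; lia. Qed.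

Lemma size_lex_bitstrings k u : u \in lex_bitstrings k -> size u = k.
Proof.
elim: k u => [|k IH] u /=; first by rewrite inE => /eqP ->.
by rewrite mem_cat => /orP[] /mapP[v /IH <- ->].
Qed.

(* [bin_nat (rev u)] is the position of [u] in the lexicographic order. *)
Lemma lex_bitstrings_iota k : [seq bin_nat (rev u) | u <- lex_bitstrings k] = iota 0 (2 ^ k).
Proof.
elim: k => // k IH; rewrite /= map_cat -!map_comp expnS mul2n -addnn iotaD; congr (_ ++ _).
  by rewrite -IH; apply: eq_map => u /=; rewrite rev_cons bin_nat_rcons addn0.
rewrite add0n -{1}(addn0 (2 ^ k)) iotaDl -IH -map_comp.
apply/eq_in_map => u /size_lex_bitstrings Eu /=.
by rewrite rev_cons bin_nat_rcons size_rev Eu mul1n addnC.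
Qed.

Lemma ttE s k x C y : decode s k x = Some C -> size y = 2 ^ k ->
  (forall u, size u = k -> circuit_eval C u = nth false y (bin_nat (rev u))) ->
  tt s k x = y.
Proof.
move=> dx Ey HC; rewrite /tt dx.
rewrite -[RHS](mkseq_nth false) /mkseq Ey -lex_bitstrings_iota -map_comp.
by apply/eq_in_map => u /size_lex_bitstrings /HC.
Qed.

Definition code_gate (w : nat) (g : gate) : seq bool :=
  match g with
  | GNot i => [:: false; true] ++ bits w i ++ bits w 0
  | GAnd i j => [:: true; false] ++ bits w i ++ bits w j
  | GOr i j => [:: true; true] ++ bits w i ++ bits w j
  end.

Lemma size_code_gate w g : size (code_gate w g) = 2 + 2 * w.
Proof. by case: g => [i|i j|i j] /=; rewrite size_cat !size_bits; lia. Qed.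

Lemma code_gateK w g n : gate_wf n g -> n <= 2 ^ w -> gate_of_block w (code_gate w g) = Some g.
Proof.
case: g => [i|i j|i j] /=; [move=> lt_i|case/andP=> lt_i lt_j..] => le_n;
  rewrite /gate_of_block /= !drop0 take_size_cat ?size_bits // ?drop_size_cat ?size_bits //
    ?(take_oversize (s := bits _ _)) ?size_bits // ?bin_nat_bits //; lia.
Qed.

Lemma blocks_cat (T : Type) l (bs : seq (seq T)) (r : seq T) :
  all (fun b => size b == l) bs -> size r < l ->
  [seq take l (drop (i * l) (flatten bs ++ r)) | i <- iota 0 (size (flatten bs ++ r) %/ l)] = bs.
Proof.
move=> Hbs lt_r; have l_gt0 : 0 < l by lia.
have -> : size (flatten bs ++ r) %/ l = size bs.
  have -> : size (flatten bs ++ r) = size bs * l + size r.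
    rewrite size_cat; congr (_ + _); elim: bs Hbs => //= b bs IH /andP[/eqP Eb /IH].
    by rewrite size_cat Eb mulSn => ->.
  by rewrite divnMDl // divn_small // addn0.
elim: bs Hbs => //= b bs IH /andP[/eqP Eb /IH {}IH].
rewrite mul0n drop0 -catA take_size_cat //; congr (_ :: _).
rewrite -[1]add1n iotaDl -map_comp -[RHS]IH; apply: eq_map => i /=.
by rewrite -[1 + i]/(i.+1) mulSn addnC -drop_drop drop_size_cat.
Qed.

Lemma circuit_wf_gates n C : circuit_wf n C -> all (gate_wf (n + size C)) C.
Proof.
have gate_wfW m p g : m <= p -> gate_wf m g -> gate_wf p g.
  by move=> le_mp; case: g => [i|i j|i j] /=; [|case/andP..]; lia.
elim: C n => //= g C IH n /andP[wf_g /IH]; rewrite addSnnS => ->.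
by rewrite andbT; apply: gate_wfW wf_g; apply: leq_addr.
Qed.

Lemma nseqM (T : Type) (x : T) m n : nseq (m * n) x = flatten (nseq m (nseq n x)).
Proof. by elim: m => [|m IH]; rewrite ?mul0n // mulSn nseqD IH. Qed.

(** The long padding stands in front, where a loop can write it before a short string of advice. It
    must consist of whole blocks to keep the gates aligned; the remainder [r] goes to the end, where
    an incomplete block is dropped. *)
Lemma decode_code s k t r C : let w := up_log 2 (k + s) in let l := 2 + 2 * w in
  circuit_wf k C -> size C <= s -> r < l ->
  decode s k (nseq (t * l) false ++ flatten (map (code_gate w) C) ++ nseq r false) = Some C.
Proof.
move=> w l wf_C le_C lt_r; rewrite /decode -/w -/l.
rewrite nseqM.
rewrite catA -flatten_cat blocks_cat; first last.
- by rewrite size_nseq.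
- rewrite all_cat all_nseq size_nseq eqxx orbT.
  rewrite all_map (@eq_all _ _ predT) ?all_predT // => g /=.
  by rewrite size_code_gate eqxx.
have -> : pmap (gate_of_block w) (nseq t (nseq l false) ++ map (code_gate w) C) = C.
  have le_w : k + size C <= 2 ^ w by rewrite (leq_trans _ (up_logP _ _)) // leq_add2l.
  rewrite pmap_cat (_ : pmap _ (nseq t _) = [::]); last by elim: t.
  have : all (gate_wf (k + size C)) C by apply: circuit_wf_gates.
  move: (k + size C) le_w => n le_n; clear -le_n; elim: C => //= g C IH /andP[wf_g wf_C].
  by rewrite (code_gateK wf_g le_n) /= IH.
by rewrite wf_C le_C.
Qed.

(** * Presentable sequences *)

Lemma str_of_tape_cat t :
  exists2 q, tright t = map Some (str_of_tape t) ++ q & head None q = None.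
Proof.
case: t => l r; rewrite /str_of_tape /=; elim: r => [|[b|] r [q Er Eq]] /=; first by exists [::].
- by exists q => //; rewrite {1}Er.
- by exists (None :: r).
Qed.

Lemma size_str_of_tape t : size (str_of_tape t) <= size (tright t).
Proof. by have [q -> _] := str_of_tape_cat t; rewrite size_cat size_map leq_addr. Qed.

(** The factor 2 arises because a step may write on an unlisted cell and then move left, which lists
    two more cells. *)
Lemma size_clocked_run a (f : clocked a) (x : 'I_a -> seq bool) :
  size (clocked_run f x) <= 2 * ((\sum_(i < a) size (x i)) ^ cexp f + cexp f).
Proof.
rewrite /clocked_run; set N := _ + cexp f; apply: leq_trans (size_str_of_tape _) _.
elim: N => [|N IH]; first by rewrite /= ffunE.
rewrite iterS; move: (iter N _ _) IH => cf IH; rewrite /mstep.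
case: ifP => _; first lia.
rewrite /= ffunE; move: (mtrans _ _).2 => r.
move: (cf.2 (inr None)) IH => t IH; case: (r (inr None)) => b [] /=; rewrite size_behead; lia.
Qed.

(* The program does not depend on [k]; the time [2 ^ O(k)] and the length of the
   output are polynomial in [2 ^ k] and not in the length of the advice. *)
Record presentation (g : nat -> seq bool) := Presentation {
  pr_tapes : finType;
  pr_cmd : cmd pr_tapes;
  pr_out : pr_tapes;
  pr_advice : nat -> pr_tapes -> seq bool;
  pr_time : nat -> nat;
  pr_subpoly : forall i, subpoly (fun k => size (pr_advice k i));
  pr_polyb : polyb pr_time;
  pr_size : polyb (fun k => size (g k));
  pr_run : eventual (fun k => exists s t,
    [/\ exec pr_cmd (fun i => str_cells (pr_advice k i)) (pr_time k) s,
        s pr_out = itape_of t & str_of_tape t = g k])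
}.

Definition presentable g : Prop := inhabited (presentation g).

(** The run of [b] may be too long for advice; its length in binary is not, and a loop writes the
    run in front of [u k]. *)
Lemma presentable_padding (n : nat -> nat) b (u : nat -> seq bool) :
  polyb n -> subpoly (fun k => size (u k)) -> presentable (fun k => nseq (n k) b ++ u k).
Proof.
move=> pn su; have [v [sv Ev]] := polyb_bits pn.
pose c : cmd bool := repeat false (Seq (keep true MLeft) (act1 true (fun=> (Some b, MStay)))).
constructor; apply: (@Presentation _ bool c true (fun k i => if i then u k else v k)
  (fun k => (n k).+1 * (2 + 7 * size (v k) + 10))).
- by case.
- apply: polybM; first by apply: polyb_le (polybD (polyb_const 1) pn); apply: filterE => k.
  apply: polyb_sub; apply: (@subpolyD (fun k => 2 + 7 * size (v k))); last exact: subpoly_const.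
  apply: (@subpolyD (fun=> 2)); first exact: subpoly_const.
  by apply: (@subpolyM (fun=> 7)) => //; apply: subpoly_const.
- apply: polyb_le (polybD pn (polyb_sub su)); apply: filterE => k.
  by rewrite size_cat size_nseq.
apply: filterS Ev => k Ev.
pose s m (i : bool) : itape := if i then str_cells (nseq m b ++ u k) else str_cells (v k).
have [|T HT] := @exec_repeat _ false (Seq (keep true MLeft) (act1 true (fun=> (Some b, MStay)))) (v
  k) s 2.
  move=> m T _; apply: (@ExSeq _ _ _ _ (upd (upd (s m) false T) true (cells [::] (None :: map Some
    (nseq m b ++ u k)))) _ 1 1).
    exact: (@exec_keep_left _ _ _ [::]).
  have -> : upd (s m.+1) false T = upd (upd (upd (s m) false T) true (cells [::] (None :: map Some
    (nseq m b ++ u k))))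
      true (str_cells (b :: nseq m b ++ u k)).
    by apply: funext => -[].
  by apply: exec_act1; rewrite upd_same iact_stay.
rewrite Ev in HT.
exists (upd (s (n k)) false T), (Tape [::] (map Some (nseq (n k) b ++ u k))); split => //.
  rewrite (_ : (fun i => _) = upd (s 0) false (str_cells (v k))) //.
  by apply: funext => -[].
by rewrite /str_of_tape /=; elim: (nseq _ _ ++ _) => //= d r ->.
Qed.

(** * Closure under clocked machines *)

Section Composition.

Variables (a : nat) (M : machine a) (J : 'I_a -> finType)
  (c : forall j, cmd (J j)) (out : forall j, J j).

(* The tapes of the programs [c j], those of [M], one tape for each state of [M],
   telling whether it is the current one, and a counter. *)
Definition comp_tapes : finType :=
  ({j : 'I_a & J j} + ((tape_index a (mwork M) + 'I_(mstates M)) + unit))%type.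

Definition prog_tape (j : 'I_a) (i : J j) : comp_tapes := inl (Tagged (fun j => J j : Type) i).
Definition mach_tape (x : tape_index a (mwork M)) : comp_tapes := inr (inl (inl x)).
Definition state_tape (q : 'I_(mstates M)) : comp_tapes := inr (inl (inr q)).
Definition counter : comp_tapes := inr (inr Datatypes.tt).

Lemma prog_tape_inj j : injective (@prog_tape j).
Proof.
pose F j : Type := J j.
by move=> x y [] /eqP; rewrite -/(Tagged F x) -/(Tagged F y) eq_Tagged => /eqP.
Qed.

Definition sim_state (h : comp_tapes -> symbol) : 'I_(mstates M) :=
  odflt (mstart M) [pick q | h (state_tape q) == Some true].

(** An [Act] sees all the heads at once. With the current state on tapes as well, a step of [M] is a
    single [Act], and the simulation is one loop with a constant body. *)
Definition sim_act (h : comp_tapes -> symbol) (i : comp_tapes) : symbol * move :=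
  let q := sim_state h in
  let r := if mhalt q then (q, [ffun x => (h (mach_tape x), MStay)]) else
    mtrans q [ffun x => h (mach_tape x)] in
  match i with
  | inr (inl (inl x)) => r.2 x
  | inr (inl (inr q')) => (if r.1 == q' then Some true else None, MStay)
  | _ => (h i, MStay)
  end.

Definition sim_config (s : comp_tapes -> itape) (cf : config M) (i : comp_tapes) : itape :=
  match i with
  | inr (inl (inl x)) => itape_of (cf.2 x)
  | inr (inl (inr q)) => cells [::] [:: if cf.1 == q then Some true else None]
  | _ => s i
  end.

Lemma sim_step s cf : act_state sim_act (sim_config s cf) = sim_config s (mstep cf).
Proof.
have Eq : sim_state (heads (sim_config s cf)) = cf.1.
  have Est q : heads (sim_config s cf) (state_tape q) = if cf.1 == q then Some true else None.
    exact: iread_cells.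
  rewrite /sim_state; case: pickP => [q|/(_ cf.1)] /=; rewrite Est; first by case: (cf.1 =P q).
  by rewrite eqxx.
apply: funext => i; rewrite /act_state /sim_act Eq.
have Eh : [ffun x => heads (sim_config s cf) (mach_tape x)] = [ffun x => tread (cf.2 x)].
  by apply/ffunP => x; rewrite !ffunE; exact: iread_of.
rewrite Eh /mstep; case: i => [i|[[x|q]|i]] /=.
- by rewrite iact_id.
- case: ifP => _ /=; first by rewrite ffunE iact_id.
  by rewrite ffunE iact_of.
- by rewrite iact_stay /=; case: (mhalt cf.1).
- by rewrite iact_id.
Qed.

Lemma sim_config_upd s cf T :
  upd (sim_config s cf) counter T = sim_config (upd s counter T) cf.
Proof. by apply: funext => -[i|[[x|q]|[]]]. Qed.

Definition block (j : 'I_a) : cmd comp_tapes :=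
  Seq (lift_cmd (@prog_tape j) (c j)) (copy (prog_tape (out j)) (mach_tape (inl j))).

Definition comp_cmd : cmd comp_tapes :=
  Seq (seqs block (enum 'I_a)) (repeat counter (Act sim_act)).

Definition comp_advice (u : forall j, J j -> seq bool) (v : seq bool) (i : comp_tapes) : seq bool :=
  match i with
  | inl p => u (tag p) (tagged p)
  | inr (inl (inl _)) => [::]
  | inr (inl (inr q)) => if mstart M == q then [:: true] else [::]
  | inr (inr _) => v
  end.

Definition block_of (i : comp_tapes) : option 'I_a :=
  match i with
  | inl p => Some (tag p)
  | inr (inl (inl (inl j))) => Some j
  | _ => None
  end.

Lemma exec_blocks (r : forall j, J j -> itape) (t : 'I_a -> nat) (r' : forall j, J j -> itape)
    (x : 'I_a -> seq bool) js s :
  (forall j, exec (c j) (r j) (t j) (r' j)) ->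
  (forall j, exists2 y, r' j (out j) = itape_of y & str_of_tape y = x j) ->
  uniq js ->
  (forall j, j \in js ->
    (forall i, s (@prog_tape j i) = r j i) /\ s (mach_tape (inl j)) = str_cells [::]) ->
  exists s', [/\ exec (seqs block js) s (\sum_(j <- js) (t j + 8 * size (x j) + 5) + 1) s',
    forall j, j \in js -> s' (mach_tape (inl j)) = str_cells (x j) &
    forall i, (forall j, j \in js -> block_of i != Some j) -> s' i = s i].
Proof.
move=> Hc Hx; elim: js s => [|j js IH] s /=.
  by move=> _ _; exists s; split => //; rewrite big_nil; apply: exec_nop.
move=> /andP[j_js u_js] Hs.
have [Hr Hin] := Hs j (mem_head _ _).
pose s1 := overlay (@prog_tape j) s (r' j).
have H1 : exec (lift_cmd (@prog_tape j) (c j)) s (t j) s1.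
  have := exec_lift (@prog_tape_inj j) s (Hc j).
  by rewrite (_ : r j = (fun i => s (prog_tape i))) ?overlay_id //; apply: funext => i; rewrite Hr.
have out1 i : block_of i != Some j -> s1 i = s i.
  by move=> Hi; rewrite /s1 overlay_out // => i'; apply: contraNneq Hi => <-.
have [y Ey Exy] := Hx j.
have [q Eq q0] := str_of_tape_cat y.
have [] := @exec_copy _ s1 (prog_tape (out j)) (mach_tape (inl j)) (tleft y) (x j) q isT _ q0.
- rewrite /s1 overlay_in ?Ey; last exact: prog_tape_inj.
  by rewrite -Exy -Eq; case: (y).
- by rewrite /s1 overlay_out.
move=> T; set s2 := upd _ _ _ => H2.
have out2 i : block_of i != Some j -> s2 i = s i.
  move=> Hi; rewrite /s2 /upd; case: eqP => [Ei|_]; first by rewrite Ei eqxx in Hi.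
  by case: eqP => [Ei|_]; [rewrite Ei eqxx in Hi | apply: out1].
have [//||s' [H3 in3 out3]] := IH s2.
  move=> i i_js; have neq_ij : Some i != Some j by apply: contraNneq j_js => -[<-].
  have [Hi1 Hi2] := Hs i (mem_behead (s := j :: js) i_js).
  by split => [i'|]; rewrite out2.
exists s'; split.
- rewrite big_cons; apply: (@ExLe _ _ _ _ ((t j + (8 * size (x j) + 5)) + (\sum_(j <- js) (t j + 8
    * size (x j) + 5) + 1))).
    exact: ExSeq (ExSeq H1 H2) H3.
  by rewrite !addnA.
- move=> i; rewrite inE => /orP[/eqP ->|/in3 //].
  rewrite out3; first by rewrite /s2 upd_same.
  by move=> i' i'_js; apply: contraNneq j_js => -[->] //.
- move=> i Hi; rewrite out3 => [|i' i'_js]; last by apply: Hi; rewrite inE i'_js orbT.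
  by apply: out2; apply: Hi; apply: mem_head.
Qed.

Lemma exec_comp (u : forall j, J j -> seq bool) v (t : 'I_a -> nat) (x : 'I_a -> seq bool) :
  (forall j, exists s y, [/\ exec (c j) (fun i => str_cells (u j i)) (t j) s,
     s (out j) = itape_of y & str_of_tape y = x j]) ->
  exists s, exec comp_cmd (fun i => str_cells (comp_advice u v i))
      (\sum_j (t j + 8 * size (x j) + 5) + 1 + (bin_nat v).+1 * (1 + 7 * size v + 10)) s /\
    s (mach_tape (inr None)) = itape_of ((iter (bin_nat v) (@mstep a M) (minit M x)).2 (inr None)).
Proof.
move=> H.
have [r' Hr'] : exists r' : forall j, J j -> itape, forall j, exists y,
    [/\ exec (c j) (fun i => str_cells (u j i)) (t j) (r' j),
     r' j (out j) = itape_of y & str_of_tape y = x j].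
  exists (fun j => projT1 (cid (H j))) => j; exact: (projT2 (cid (H j))).
have [||||s' [H1 in1 out1]] := @exec_blocks (fun j i => str_cells (u j i)) t r' x (enum 'I_a)
  (fun i => str_cells (comp_advice u v i)).
- by move=> j; have [y []] := Hr' j.
- by move=> j; have [y [? ? ?]] := Hr' j; exists y.
- exact: enum_uniq.
- by [].
have Es' : s' = upd (sim_config s' (minit M x)) counter (str_cells v).
  apply: funext => -[i|[[[j|i]|q]|[]]] //=.
  - by rewrite [LHS]in1 ?mem_enum // /upd /= ffunE.
  - by rewrite [LHS]out1 // /upd /= ffunE.
  - by rewrite [LHS]out1 //= /upd /=; case: eqP => _ //; rewrite cells_blank_right.
  - by rewrite [LHS]out1.
have [|T H2] := @exec_repeat _ counter (Act sim_act) v (fun n => sim_config s' (iter n (@mstep a M)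
  (minit M x))) 1.
  by move=> n T _; rewrite !sim_config_upd iterS -sim_step; apply: ExAct.
rewrite -Es' in H2.
exists (upd (sim_config s' (iter (bin_nat v) (@mstep a M) (minit M x))) counter T); split => //.
by rewrite -big_enum; apply: ExSeq H1 H2.
Qed.

End Composition.

(** The clock [N k] is a polynomial in the lengths of the arguments, hence 2^O(k); it is given in
    binary as the counter of the simulation. *)
Lemma presentable_clocked a (f : clocked a) (g : 'I_a -> nat -> seq bool) :
  (forall j, presentable (g j)) ->
  presentable (fun k => clocked_run f (fun j => g j k)).
Proof.
move=> Hg.
have P j : presentation (g j) by apply: (projT1 (cid (_ : exists _ : presentation (g j), True)));
  case: (Hg j) => p; exists p.
pose N k := (\sum_(i < a) size (g i k)) ^ cexp f + cexp f.
have pN : polyb N.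
  apply: polybD (polyb_const _); apply: polybX; apply: polyb_sum => j; exact: pr_size (P j).
have [v [sv Ev]] := polyb_bits pN.
constructor; pose J j := pr_tapes (P j).
apply: (@Presentation (fun k => clocked_run f (fun j => g j k)) (@comp_tapes a (cmachine f) J)
  (@comp_cmd a (cmachine f) J (fun j => pr_cmd (P j)) (fun j => pr_out (P j)))
  (@mach_tape a (cmachine f) J (inr None))
  (fun k => @comp_advice a (cmachine f) J (fun j => @pr_advice _ (P j) k) (v k))
  (fun k => \sum_j (pr_time (P j) k + 8 * size (g j k) + 5) + 1 + (N k).+1 * (1 + 7 * size (v k) +
    10))).
- case=> [[j i]|[[x|q]|[]]] /=.
  + exact: pr_subpoly.
  + exact: subpoly_const.
  + by case: eqP => _; apply: subpoly_const.
  + exact: sv.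
- apply: (@polybD (fun k => \sum_j (pr_time (P j) k + 8 * size (g j k) + 5) + 1)).
    apply: polybD (polyb_const _); apply: polyb_sum => j; apply: polybD (polyb_const _).
    apply: polybD (pr_polyb (P j)) _; apply: polybM (pr_size (P j)); exact: polyb_const.
  apply: polybM; first by apply: polyb_le (polybD (polyb_const 1) pN); apply: filterE => k.
  apply: polybD (polyb_const _); apply: (@polybD (fun=> 1)); first exact: polyb_const.
  by apply: polybM (polyb_sub sv); apply: polyb_const.
- apply: polyb_le (polybM (polyb_const 2) pN); apply: filterE => k; exact: size_clocked_run.
have Hrun := filter_forall eventually_filter (fun j => pr_run (P j)).
apply: filterS2 Ev Hrun => k Ev Hrun.
have [s [H1 H2]] := @exec_comp a (cmachine f) _ _ (fun j => pr_out (P j)) (fun j => @pr_advice _ (P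
  j) k) (v k)
  (fun j => pr_time (P j) k) (fun j => g j k) Hrun.
by rewrite Ev in H1 H2; eexists s, _; split; [exact: H1 | exact: H2 | ].
Qed.

(** * The language of the bits of a presentable sequence *)

Section BitLanguage.

Variables (K : finType) (c : cmd K) (out : K).

(** Of the two outer layers, [None] is the input tape that [decider] provides and [Some None] the
    tape of the index. *)
Definition prog (i : K) : option (option K) := Some (Some i).

Definition index_tape : option (option K) := Some None.

Definition parsed_tapes : seq (option (option K)) := index_tape :: map prog (enum K).

Definition bit_cmd : cmd (option (option K)) :=
  Seq (seqs (parse_tape None) parsed_tapes)
    (Seq (lift_cmd prog c) (repeat index_tape (keep (prog out) MRight))).

Definition bit_tail (u : K -> seq bool) (n : nat) : seq bool :=
  enc_all u (enum K) ++ nseq n false.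

Lemma iread_right t n :
  iread (iter n (fun T => iact (iread T, MRight) T) (itape_of t)) = nth None (tright t) n.
Proof.
have E m : (iter n (fun T => iact (iread T, MRight) T) (itape_of t)).2 m = nth None (tright t) (n +
  m).
  by elim: n m => // n IH m; rewrite iterS [LHS]IH addSnnS.
by rewrite /iread E addn0.
Qed.

(** The index [w] has its most significant bit first, as in the lexicographic order. Parsing
    reverses it into the order that [repeat] counts with, and the output head moves right that many
    times. *)
Lemma exec_bit (u : K -> seq bool) n t s y (w : seq bool) :
  exec c (fun i => str_cells (u i)) t s -> s out = itape_of y ->
  bin_nat (rev w) < size (str_of_tape y) ->
  exists s', exec bit_cmd (decider_init (enc w ++ bit_tail u n))
      (3 * (2 * size w + 1 + size (enc_all u (enum K))) + 1 +
        (t + 2 ^ size w * (1 + 7 * size w + 10))) s' /\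
    (heads s' (prog out) == Some true) = nth false (str_of_tape y) (bin_nat (rev w)).
Proof.
move=> Hc Ey lt_w.
pose a j := match j with Some (Some i) => u i | Some None => rev w | None => [::] end.
have Eenc : enc_all a parsed_tapes = enc w ++ enc_all u (enum K).
  by rewrite /enc_all /= revK -map_comp.
have prog_inj : injective prog by move=> i j [].
have [||| l H1] := @exec_parse_all _ None a parsed_tapes (decider_init (enc w ++ bit_tail u n))
  [::] (nseq n false).
- rewrite /= !inE /=; apply/and3P; split.
  + by apply/mapP => -[].
  + by apply/mapP => -[].
  + by rewrite map_inj_uniq ?enum_uniq.
- by rewrite Eenc -catA.
- by move=> j; rewrite inE => /orP[/eqP -> //|/mapP[i _ ->]].
set s1 := upd _ _ _ in H1.
have prog_s1 : (fun i => s1 (prog i)) = (fun i => str_cells (u i)).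
  apply: funext => i; rewrite /s1 upd_other // ifT //.
  by rewrite inE map_f ?orbT // mem_enum.
have := exec_lift prog_inj s1 Hc; rewrite -prog_s1 overlay_id; set s2 := overlay _ _ _ => H2.
have index_s2 : s2 index_tape = str_cells (rev w) by rewrite /s2 overlay_out.
pose E m := iter m (fun T => iact (iread T, MRight) T) (itape_of y).
have [|T H3] := @exec_repeat _ index_tape (keep (prog out) MRight) (rev w)
  (fun m => upd s2 (prog out) (E m)) 1.
  move=> m T _; rewrite !(@updC _ _ (prog out) index_tape) //.
  have := @exec_act1 _ (upd (upd s2 index_tape T) (prog out) (E m)) (prog out) (fun h => (h (prog
    out), MRight)) _ erefl.
  by rewrite upd_upd /heads upd_same.
have Es2 : s2 = upd (upd s2 (prog out) (E 0)) index_tape (str_cells (rev w)).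
  have {1}-> : s2 = upd (upd s2 (prog out) (s2 (prog out))) index_tape (s2 index_tape).
    by rewrite upd_id upd_id.
  by rewrite index_s2 /s2 overlay_in // Ey.
rewrite -Es2 in H3.
exists (upd (upd s2 (prog out) (E (bin_nat (rev w)))) index_tape T); split.
  apply: ExLe (ExSeq H1 (ExSeq H2 H3)) _.
  rewrite Eenc size_cat size_enc size_rev.
  have := bin_nat_lt (rev w); rewrite size_rev; nia.
rewrite /heads upd_other // upd_same iread_right.
have [q -> _] := str_of_tape_cat y.
by rewrite nth_cat size_map lt_w (nth_map false).
Qed.

End BitLanguage.

Lemma nth_enc w v p : nth false (enc w ++ v) p =
  if p < 2 * size w then (if odd p then nth false w p./2 else true)
  else nth false (false :: v) (p - 2 * size w).
Proof.
elim: w p => [|b w IH] p /=; first by rewrite muln0 subn0.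
case: p => [|[|p]] //=; first by rewrite mulnS.
rewrite IH negbK mulnS; have -> : (p.+2 < 2 + 2 * size w) = (p < 2 * size w) by lia.
by case: ifP => // _; congr nth; lia.
Qed.

(** * Small circuits from hypothesis (H) *)

Section SmallCircuits.

Variable d : nat.
Hypothesis H : forall L : language, in_P L -> in_Size d L.

(** The length of [g] is a premise inside: for an element of the model it is known only on a set of
    the ultrafilter, while the circuits are to exist for all large [k]. *)
Definition table_circuit (g : seq bool) (k : nat) (C : circuit) : Prop :=
  circuit_wf k C /\ (size g = 2 ^ k -> forall u, size u = k ->
     circuit_eval C u = nth false g (bin_nat (rev u))).

Lemma presentable_small g q : presentable g -> 0 < q ->
  eventual (fun k => exists2 C, table_circuit (g k) k C & size C <= 2 ^ (k %/ q)).
Proof.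
case=> -[K c out adv time sub_adv poly_time _ run] q_gt0.
(* For [m = k %/ q'] the inputs have length O(2^m) and their circuits size O(2^(m d)). Taking [d.+1]
   instead of [d] leaves a factor [2 ^ m] to absorb constants. *)
pose q' := q * d.+1; have q'_gt0 : 0 < q' by rewrite muln_gt0 q_gt0.
pose S k := size (enc_all (adv k) (enum K)).
have sS : subpoly S.
  apply: subpoly_le (@subpoly_sum K (fun i k => 2 * size (adv k i) + 1) _) => [|i].
    apply: filterE => k; rewrite /S /enc_all size_flatten /shape -map_comp sumnE big_map big_enum
      /=.
    by apply: leq_sum => i _; rewrite size_enc size_rev; lia.
  by apply: subpolyD (subpoly_const _); apply: subpolyM (sub_adv i); apply: subpoly_const.
have sB : subpoly (fun k => 2 * k + 1 + S k).
  apply: subpolyD sS; apply: subpolyD (subpoly_const _); apply: subpolyM subpoly_id;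
    exact: subpoly_const.
have [e poly_T] : polyb (fun k => 3 * (2 * k + 1 + S k) + 1 + (time k + 2 ^ k * (1 + 7 * k + 10))).
  apply: (@polybD (fun k => 3 * (2 * k + 1 + S k) + 1)).
    by apply: polybD (polyb_const _); apply: polybM (polyb_sub sB); apply: polyb_const.
  apply: polybD poly_time _; apply: polybM polyb_exp _; apply: polyb_sub.
  apply: subpolyD (subpoly_const _); apply: (@subpolyD (fun=> 1)); first exact: subpoly_const.
  by apply: subpolyM subpoly_id; apply: subpoly_const.
(* The padded length is at least [2 ^ m.+1] and [k < m.+1 * q'], so that its power [E] is at least
   [2 ^ (e * k)], the bound on the time. The successor keeps [E] positive when [e = 0]. *)
pose E := e.+1 * q'; have E_gt0 : 0 < E by rewrite muln_gt0.
(* One language serves all [k], as everything that varies with [k] is in the input; hence the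
   constant [b] is independent of [k]. The clock exponent depends on [q], but [d] does not. *)
pose L u := head false (clocked_run (Clocked (decider (Seq (bit_cmd c out) (Act (@stay_act _)))
  (Some out)) E) (fun=> u)).
have [b Hb] : in_Size d L.
  apply: H; apply: decider_in_P; last by rewrite muln_gt0.
  by rewrite /= size_cat addn1.
(* The factor [4 ^ d] comes from [l <= 4 * 2 ^ m], the summand 4 from the gates that
   [circuit_restrict] adds. *)
have ev : eventual (fun k => 0 < k /\ b * 4 ^ d + 4 <= k %/ q').
  by apply: filterS (eventual_ge ((b * 4 ^ d + 4) * q')) => k; rewrite -leq_divRL // => le_k;
    split=> //; have := leq_div k q'; lia.
have evB := sB _ q'_gt0.
apply: filterS3 (filterI ev evB) run poly_T => k [[k_gt0 le_m] le_B] [s [y [Hs Ey Eg]]] le_T.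
pose m := k %/ q'; rewrite -/m in le_m le_B.
(* The padding is never read: it only raises the clock [l ^ E + E]. *)
pose pad := 2 ^ m.+1.
pose W := bit_tail (adv k) pad.
pose l := 2 * k + 1 + size W.
have El : l = 2 * k + 1 + S k + pad by rewrite /l /W size_cat size_nseq addnA.
have pad_gt0 : 0 < pad by rewrite expn_gt0.
have [|C [wf_C size_C HC]] := Hb l; first by rewrite El; lia.
(* Only the odd positions below [2 * k] carry bits of the index; markers, advice and padding are
   constants. *)
pose f p : nat + bool := if p < 2 * k then (if odd p then inl p./2 else inr true)
  else inr (nth false (false :: W) (p - 2 * k)).
have [||C' [wf_C' size_C' HC']] := @circuit_restrict l k f k_gt0 _ C _ wf_C.
- move=> p i; rewrite /f; case: ifP => // lt_p; case: ifP => // odd_p [<-];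
    by rewrite ltn_half_double -mul2n.
- by rewrite El; lia.
exists C'.
  split=> // size_g u size_u.
  rewrite (HC' u (enc u ++ W)) //; last first.
  - by move=> p lt_p; rewrite nth_enc size_u /f; do ! case: ifP.
  - by rewrite size_cat size_enc size_u /l; lia.
  rewrite HC; last by rewrite size_cat size_enc size_u /l; lia.
  have lt_u : bin_nat (rev u) < size (str_of_tape y).
    by rewrite Eg size_g; have := bin_nat_lt (rev u); rewrite size_rev size_u.
  have [s' [Hs' Hbit]] := exec_bit pad Hs Ey lt_u.
  rewrite /L (decider_run _ Hs') /= ?[heads _ _ == _]Hbit ?Eg //.
  rewrite size_u -/W size_cat size_enc size_u.
  apply: leq_ltn_trans le_T _.
  have -> : k.*2.+1 + size W = l by rewrite /l; lia.
  apply: (@leq_ltn_trans (l ^ E)); last by rewrite -[X in X < _]addn0 ltn_add2l.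
  apply: (@leq_trans (pad ^ E)); last by rewrite leq_exp2r // El; lia.
  rewrite -expnM leq_exp2l //.
  have : k < m.+1 * q' by apply: ltn_ceil.
  rewrite /E; nia.
rewrite size_C'; apply: leq_trans (leq_add size_C (leqnn _)) _.
have le_l : l ^ d <= 4 ^ d * 2 ^ (m * d).
  by rewrite expnM -expnMn; case: (d) => // d'; rewrite leq_exp2r // El /pad expnS; lia.
have Em : m = (k %/ q) %/ d.+1 by rewrite -divnMA.
apply: (@leq_trans (2 ^ m * 2 ^ (m * d))); last first.
  by rewrite -expnD -mulnS leq_exp2l // Em leq_divM.
apply: (@leq_trans ((b * 4 ^ d + 4) * 2 ^ (m * d))); last first.
  by rewrite leq_mul // (leq_trans le_m) // ltnW // ltn_expl.
have : 0 < 2 ^ (m * d) by rewrite expn_gt0.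
move: le_l; move: (l ^ d) (4 ^ d) (2 ^ (m * d)) => x1 x2 x3; nia.
Qed.

(** The circuits of [presentable_small] vary with [q]; one of least size obeys the bounds for all
    [q] at once. *)
Lemma presentable_circuits g : presentable g ->
  exists C : nat -> circuit, subpoly (fun k => size (C k)) /\
    eventual (fun k => table_circuit (g k) k (C k)).
Proof.
move=> Hg.
have [|C HC] := @boolp.choice _ _ (fun k C => forall C', table_circuit (g k) k C' ->
    table_circuit (g k) k C /\ size C <= size C').
  move=> k.
  have [[C0 HC0]|none] := pselect (exists C, table_circuit (g k) k C); last first.
    by exists [::] => C' HC'; case: none; exists C'.
  have ex : exists n, `[< exists2 C, table_circuit (g k) k C & size C = n >].
    by exists (size C0); apply/asboolP; exists C0.
  case: (ex_minnP ex) => n /asboolP[C HC En] min_n.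
  by exists C => C' HC'; split=> //; rewrite En min_n //; apply/asboolP; exists C'.
exists C; split=> [q q_gt0|].
  by apply: filterS (presentable_small Hg q_gt0) => k [C' /HC[_ le_C]]; apply: leq_trans.
by apply: filterS (presentable_small Hg (isT : 0 < 1)) => k [C' /HC[]].
Qed.

End SmallCircuits.

(** * The model *)

Lemma teval_subst (S : nat -> Type) (M : structure S) (e : nat -> dom M) r t :
  teval e (tsubst r t) = teval (fun i => teval e (r i)) t.
Proof.
elim: t => //= a f ts IH; congr (interp _ _); apply: funext => i.
by rewrite ffunE IH.
Qed.

(** * Truth modulo an ultrafilter *)

Section ReducedPower.

Variable U : set_system nat.
Hypothesis ultraU : UltraFilter U.

Let properU : ProperFilter U := ultra_proper.
Let filterU : Filter U. Proof. exact _. Qed.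

Definition element (g : nat -> nat) : Prop := presentable (fun k => str_of_nat (g k)).

Definition at_index (e : nat -> nat -> nat) (k : nat) : nat -> dom std_model := fun i => e i k.

Definition seval (e : nat -> nat -> nat) (t : term clocked) (k : nat) : nat :=
  teval (at_index e k) t.

(* Satisfaction in the structure of the presentable sequences modulo [U]; equality
   is interpreted by the congruence, which saves forming the quotient. *)
Fixpoint satU (e : nat -> nat -> nat) (A : formula clocked) : Prop :=
  match A with
  | Bot => False
  | Eq t u => U (fun k => seval e t k = seval e u k)
  | Imp B C => satU e B -> satU e C
  | All B => forall g, element g -> satU (scons g e) B
  end.

Lemma element_seval e t : (forall i, element (e i)) -> element (seval e t).
Proof.
move=> He; elim: t => [i|a f ts IH]; first exact: He.
rewrite /element (_ : (fun k => _) =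
  (fun k => clocked_run f (fun j => str_of_nat (seval e (ts j) k)))).
  exact: (presentable_clocked f IH).
by apply: funext => k; rewrite /seval /= nat_of_strK.
Qed.

Lemma seval_subst e r t : seval e (tsubst r t) = seval (fun i => seval e (r i)) t.
Proof. by apply: funext => k; rewrite /seval teval_subst. Qed.

Lemma seval_shift g e t : seval (scons g e) (tshift t) = seval e t.
Proof. by rewrite /tshift seval_subst. Qed.

Lemma satU_subst A e r : satU e (fsubst r A) <-> satU (fun i => seval e (r i)) A.
Proof.
elim: A e r => [|t u|B IHB C IHC|B IHB] e r /=; first by [].
- by rewrite !seval_subst.
- by split=> H HB; apply/IHC/H/IHB.
- have E g : (fun i => seval (scons g e) (scons (Var 0) (fun j => tshift (r j)) i)) =
      scons g (fun i => seval e (r i)).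
    by apply: funext => -[|i] //=; apply: seval_shift.
  by split=> H g Hg; [rewrite -E; apply/IHB/H | apply/IHB; rewrite E; apply: H].
Qed.

Lemma satU_shift A g e : satU (scons g e) (fshift A) <-> satU e A.
Proof. exact: satU_subst. Qed.

Lemma satU_inst A t e : satU e (finst A t) <-> satU (scons (seval e t) e) A.
Proof.
rewrite /finst satU_subst (_ : (fun i => _) = scons (seval e t) e) //.
by apply: funext => -[].
Qed.

Lemma seval_congr e e' t : (forall i, U (fun k => e i k = e' i k)) ->
  U (fun k => seval e t k = seval e' t k).
Proof.
move=> He; elim: t => [i|a f ts IH]; first exact: He.
have := filter_forall filterU IH; apply: filterS => k Hk.
by rewrite /seval /=; congr (nat_of_str (clocked_run f _)); apply: funext => i;
  rewrite [teval _ _]Hk.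
Qed.

(** Equality means agreement on a set of [U]; the substitution rule is sound because every formula
    respects this congruence. *)
Lemma satU_congr A e e' : (forall i, U (fun k => e i k = e' i k)) -> satU e A <-> satU e' A.
Proof.
elim: A e e' => [|t u|B IHB C IHC|B IHB] e e' He /=; first by [].
- have := seval_congr u He; have := seval_congr t He => Ht Hu.
  by split; apply: filterS3 Ht Hu => k -> ->.
- by split=> H /(IHB _ _ He) /H /(IHC _ _ He).
- have Hg g i : U (fun k => scons g e i k = scons g e' i k).
    by case: i => [|i] /=; [apply: filterE | apply: He].
  by split=> H g /H /(IHB _ _ (Hg g)).
Qed.

Lemma satU_sound G A : proves G A ->
  forall e, (forall i, element (e i)) -> (forall B, G B -> satU e B) -> satU e A.
Proof.
elim=> {G A} [G A GA|G A B _ IH|G A B _ IHAB _ IHA|G A _ IH|G A _ IH|G A t _ IH|G t|G A t u _ IHtu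
  _ IHA] e He HG.
- exact: HG.
- by move=> HA; apply: IH => // C [->|/HG].
- by apply: IHAB => //; apply: IHA.
- by apply: contrapT => nA; apply: (IH e) => // C [->|/HG].
- move=> g Hg; apply: IH => [[|i]|C [B GB ->]]; [exact: Hg | exact: He |].
  exact: (proj2 (satU_shift B g e) (HG B GB)).
- apply: (proj2 (satU_inst A t e)); apply: (IH e) => //; exact: element_seval.
- exact: filterE.
- apply: (proj2 (satU_inst A u e)).
  apply: (proj1 (@satU_congr A (scons (seval e t) e) _ _)) (proj1 (satU_inst A t e) (IHA e He HG)).
  case=> [|i] /=; first exact: IHtu e He HG.
  exact: filterE.
Qed.

(** The quantifier-free part of the theorem of Łoś; quantifiers would range over presentable
    sequences only. Implication is the case that uses maximality of [U], to decide whether the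
    premise holds on a set of [U]. *)
Lemma satU_quantifier_free A e : quantifier_free A ->
  satU e A <-> U (fun k => sat (at_index e k) A).
Proof.
elim: A => [|t u|B IHB C IHC|//] /=.
- by move=> _; split=> //; apply: filter_not_empty.
- by [].
move=> /andP[/IHB{}IHB /IHC{}IHC]; split=> [H|H /IHB UB]; last first.
  by apply/IHC; apply: filterS2 H UB => k; apply.
have [/IHB/H/IHC|nB] := in_ultra_setVsetC (fun k => sat (at_index e k) B) ultraU.
  by apply: filterS => k.
by apply: filterS nB => k /= nB HB; case: nB.
Qed.

(** A true universal sentence holds at each index for whatever values the sequences take there. *)
Lemma satU_universal n B e : quantifier_free B ->
  (forall e' : nat -> dom std_model, sat e' (iter n (@All clocked) B)) ->
  satU e (iter n (@All clocked) B).
Proof.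
move=> qfB; elim: n e => [|n IH] e /= HB.
  by apply/satU_quantifier_free => //; apply: filterE => k; apply: HB.
move=> g _; apply: IH => e'.
by have := HB (fun i => e' i.+1) (e' 0); congr (sat _ _); apply: funext => -[].
Qed.

Lemma satU_T_PV e A : T_PV A -> satU e A.
Proof. by case=> -[_ [n [B [-> qfB]]]] HA; apply: satU_universal. Qed.

End ReducedPower.

(** * Bounds on the parameters of the truth-table function *)

Section Sizes.

Variables (R : realType) (eps : R).
Hypotheses (eps_gt0 : (0 < eps)%R) (eps_lt1 : (eps < 1)%R).

Lemma tt_size_le k : tt_size eps k <= 2 ^ k.
Proof.
rewrite -(ler_nat R); apply: le_trans (_ : powR 2 (eps * k%:R) <= _)%R.
  by rewrite truncn_le powR_ge0.
rewrite natrX -powR_mulrn //; apply: ler_powR; first by rewrite ler1n.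
by rewrite ler_piMl // ltW.
Qed.

Lemma subpoly_tt_size h : subpoly h -> eventual (fun k => h k <= tt_size eps k).
Proof.
(* Since [q] exceeds 1/eps, [k %/ q] is at most [eps * k]; as [2 ^ (k %/ q)] is an integer, the
   inequality survives the truncation in [tt_size]. *)
move=> sh; pose q := (Num.truncn eps^-1).+1.
have Hq : (1 <= eps * q%:R)%R.
  by rewrite mulrC -ler_pdivrMr // mul1r ltW // truncnS_gt.
apply: filterS (sh q isT) => k le_h; apply: leq_trans le_h _.
rewrite /tt_size truncn_ge_nat ?powR_ge0 // natrX -powR_mulrn //.
apply: ler_powR; first by rewrite ler1n.
apply: le_trans (_ : (eps * q%:R) * (k %/ q)%:R <= _)%R; first by rewrite ler_peMl.
by rewrite -mulrA -natrM ler_pM2l // ler_nat mulnC leq_divM.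
Qed.

(** The lower bound leaves room for codes of length 2^o(k); the upper one keeps the padding within
    2^O(k). *)
Lemma tt_inputs_bounds k : 2 <= tt_size eps k ->
  tt_size eps k <= tt_inputs eps k <= 10 * 2 ^ k * k.
Proof.
rewrite /tt_inputs; move: (tt_size_le k); move: (tt_size eps k) => s le_s s_ge2.
have ln2_gt0 : (0 < ln (2 : R))%R by rewrite ln_gt0 // ltr1n.
have s_gt0 : (0 < s%:R :> R)%R by rewrite ltr0n; lia.
pose y : R := (ln s%:R / ln 2)%R.
have y_ge1 : (1 <= y)%R by rewrite ler_pdivlMr // mul1r ler_ln ?posrE // ler_nat.
have y_ge0 : (0 <= y)%R by apply: le_trans y_ge1; apply: ler01.
have y_le : (y <= k%:R)%R.
  rewrite ler_pdivrMr // mulr_natl -lnXn // ler_ln ?posrE ?exprn_gt0 //.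
  by rewrite -natrX ler_nat.
have x_ge : (s%:R <= 10 * s%:R * y :> R)%R.
  rewrite -mulrA mulrCA ler_peMr ?ler0n //; apply: le_trans y_ge1 _.
  have ge10 : (1 <= 10 :> R)%R by rewrite (ler_nat R 1 10).
  exact: ler_peMl.
have x_le : (10 * s%:R * y <= (10 * 2 ^ k * k)%:R :> R)%R.
  rewrite !natrM; apply: ler_pM => //; first by rewrite mulr_ge0 ?ler0n.
  by apply: ler_pM; rewrite ?ler0n // ler_nat.
have c_ge0 : (0 <= Num.ceil (10 * s%:R * y))%R.
  by rewrite -(ler_int R) (le_trans _ (ceil_ge _)) // (le_trans _ x_ge) // ltW.
rewrite -!lez_nat gez0_abs //; apply/andP; split.
  by rewrite -(ler_int R) (le_trans x_ge) // ceil_ge.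
by rewrite ceil_le_int.
Qed.

End Sizes.

(** * Preimages in the model and the conclusion *)

Lemma presentable_tt_preimage (d : nat) (R : realType) (eps : R) (y : nat -> seq bool) :
  (forall L : language, in_P L -> in_Size d L) -> (0 < eps)%R -> (eps < 1)%R ->
  presentable y ->
  exists x, presentable x /\ eventual (fun k => size (x k) = tt_inputs eps k /\
    (size (y k) = 2 ^ k -> tt (tt_size eps k) k (x k) = y k)).
Proof.
move=> H eps_gt0 eps_lt1 Hy.
have [C [sub_C tab_C]] := presentable_circuits H Hy.
pose w k := up_log 2 (k + tt_size eps k).
pose l k := 2 + 2 * w k.
pose u k := flatten (map (code_gate (w k)) (C k)).
have size_u k : size (u k) = size (C k) * l k.
  by rewrite /u; elim: (C k) => //= g D IH; rewrite size_cat size_code_gate IH mulSn.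
pose n k := tt_inputs eps k - size (C k) * l k.
have le_w k : w k <= k.+1.
  apply: up_log_min => //; rewrite expnS.
  have := tt_size_le eps_lt1 k; have := ltn_expl k (isT : 1 < 2); lia.
have sub_l : subpoly l.
  apply: (@subpoly_le _ (fun k => 4 + 2 * k)).
    by apply: filterE => k; rewrite /l; have := le_w k; lia.
  by apply: (@subpolyD (fun=> 4)); [exact: subpoly_const | apply: subpolyM subpoly_id;
    exact: subpoly_const].
have sub_u : subpoly (fun k => size (u k)).
  by apply: subpoly_le (subpolyM sub_C sub_l); apply: filterE => k; rewrite size_u.
have bounds : eventual (fun k => [/\ tt_size eps k <= tt_inputs eps k, size (u k) <= tt_size eps k,
    size (C k) <= tt_size eps k & tt_inputs eps k <= 10 * 2 ^ k * k]).
  apply: filterS3 (subpoly_tt_size eps_gt0 sub_u) (subpoly_tt_size eps_gt0 sub_C)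
    (subpoly_tt_size eps_gt0 (subpoly_const 2)) => k le_u le_C /(tt_inputs_bounds eps_gt0
      eps_lt1)/andP[].
  by split.
(* The [n k] padding bits are split by division by the block length: whole blocks in front, written
   by a loop, and fewer than [l k] bits behind, so that what follows the run still has length
   2^o(k). *)
exists (fun k => nseq (n k %/ l k * l k) false ++ (u k ++ nseq (n k %% l k) false)); split.
  apply: presentable_padding.
    apply: polyb_le (polybM (polybM (polyb_const 10) polyb_exp) (polyb_sub subpoly_id)).
    apply: filterS bounds => k [_ _ _]; apply: leq_trans.
    by apply: leq_trans (leq_divM _ _) _; apply: leq_subr.
  apply: subpoly_le (subpolyD sub_u sub_l); apply: filterE => k.
  by rewrite size_cat size_nseq leq_add2l ltnW // ltn_mod.
apply: filterS2 bounds tab_C => k [le1 le2 le3 _] [wf_C HC]; split.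
  rewrite !size_cat !size_nseq addnCA -divn_eq /n -size_u subnKC //.
  exact: leq_trans le1.
move=> size_y; apply: ttE => //; last exact: HC.
by apply: decode_code; rewrite ?ltn_mod.
Qed.

Theorem theorem1 :
  (exists d : nat, (1 <= d)%N /\ forall L : language, in_P L -> in_Size d L) ->
  forall (R : realType) (eps : R), (0 < eps)%R -> (eps < 1)%R ->
  forall A : formula clocked, defines_dwphp_rel eps A ->
  ~ proves T_PV (dwphp_sentence A).
Proof.
case=> d [_ H] R eps eps_gt0 eps_lt1 A [qfA _ defA] pr.
have [U [ultraU leU]] := ultraFilterLemma eventually_filter.
(* Soundness speaks of an environment of elements; every variable is sent to the constant sequence
   0. *)
have short0 : element (fun=> 0).
  exact: (presentable_padding false (polyb_const 0) (subpoly_const 0 : subpoly (fun=> size [::]))).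
have Hz : element (fun k => nat_of_str (nseq (2 ^ k) true)).
  rewrite /element (_ : (fun k => _) = (fun k => nseq (2 ^ k) true ++ [::])).
    exact: (presentable_padding true polyb_exp (subpoly_const 0 : subpoly (fun=> size [::]))).
  by apply: funext => k; rewrite nat_of_strK cats0.
have := satU_sound ultraU pr (fun=> short0) (fun B => @satU_T_PV _ ultraU _ B) _ Hz.
(* [Ex] is a negated universal formula, so it remains to refute each candidate [y] by a preimage. *)
move=> /= noY; apply: noY => y Hy allX.
have [x [Hx xP]] := presentable_tt_preimage H eps_gt0 eps_lt1 Hy.
have Ex : element (fun k => nat_of_str (x k)).
  by rewrite /element (_ : (fun k => _) = x) //; apply: funext => k; rewrite nat_of_strK.
have /(satU_quantifier_free ultraU _ qfA) UA := allX _ Ex.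
(* On a set of [U] the relation denies that [x k] is a preimage of [y k], and it also provides the
   length of [y k] under which [x k] is one; so [U] would contain the empty set. *)
have /filter_not_empty [] : ProperFilter U by exact: ultra_proper.
have ev : eventual (fun k => 0 < k /\ size (x k) = tt_inputs eps k /\
    (size (str_of_nat (y k)) = 2 ^ k -> tt (tt_size eps k) k (x k) = str_of_nat (y k))).
  by apply: filterI xP; exact: eventual_ge.
apply: filterS2 UA (leU _ ev) => k Ak [k_gt0 [size_x Htt]].
have /defA rel : sat (scons (nat_of_str (x k) : dom std_model)
    (scons (nat_of_str (str_of_nat (y k)) : dom std_model)
      (scons (nat_of_str (nseq (2 ^ k) true) : dom std_model) (fun=> 0)))) A.
  rewrite str_of_natK; congr (sat _ A): Ak.
  by apply: funext => -[|[|[|i]]].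
have pow_gt1 : 1 < 2 ^ k by rewrite (@ltn_exp2l 2 0 k).
have [size_y neq] := rel k pow_gt1 erefl.
exact: neq size_x (Htt size_y).
Qed.
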